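(* The symmetric monoidal category $\mathbf{Corel}$ of corelations between finite sets (with monoidal product the disjoint union) is equivalent, as a symmetric monoidal category, to $\mathbf{Th(ESCFM)}$, the prop for extraspecial commutative Frobenius monoids.
   Context: **Corelations.** A corelation $\alpha\colon X\to Y$ between sets $X$ and $Y$ is a partition of the disjoint union $X+Y$. Given another corelation $\beta\colon Y\to Z$, the composite $\beta\circ\alpha\colon X\to Z$ is the restriction to $X+Z$ of the finest partition of $X+Y+Z$ that is coarser than both $\alpha$ and $\beta$ when restricted to $X+Y$ and $Y+Z$ respectively. The identity on $X$ is the partition of $X+X$ whose classes are the pairs consisting of the two copies of each $x\in X$. $\mathbf{Corel}$ is the symmetric monoidal category with objects finite sets, morphisms corelations between finite sets, and monoidal product disjoint union (on morphisms, the disjoint union of partitions). The unitors, associator and braiding are those of finite sets under disjoint union, where a bijection $f\colon X\to Y$ is regarded as the corelation whose classes are the sets $\{x,f(x)\}$. **Props and theories.** A prop is a symmetric strict monoidal category whose objects are the natural numbers and whose tensor product on objects is addition; a morphism of props is an identity-on-objects symmetric strict monoidal functor. A signature $\Sigma$ is a set of formal generators $\sigma\colon n\to m$ ($n,m\in\mathbb N$). $\Sigma$-terms are built inductively from the empty term $\varnothing\colon 0\to0$ (the identity on $0$), $\mathrm{id}\colon1\to1$, the braiding $s\colon2\to2$, and the generators, using composition $\circ$ and monoidal sum $+$. The free prop $F\Sigma$ (the value at $\Sigma$ of the left adjoint of the underlying-signature functor $\mathbf{PROP}\to\mathbf{Set}^{\mathbb N\times\mathbb N}$) has as morphisms the $\Sigma$-terms,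 modulo the axioms of symmetric strict monoidal categories. A symmetric monoidal theory $(\Sigma,E)$ is a signature together with a set $E$ of equations, i.e. pairs of $\Sigma$-terms of the same type. Regarding $E$ also as a signature, the prop for $(\Sigma,E)$ is the coequalizer in the category of props of the two maps $\lambda,\rho\colon FE\rightrightarrows F\Sigma$ sending each equation to its first, respectively second, term. **Extraspecial commutative Frobenius monoids.** $\mathbf{Th(ESCFM)}$ is the prop for the theory with generators $\mu\colon2\to1$, $\eta\colon0\to1$, $\delta\colon1\to2$, $\epsilon\colon1\to0$ and equations - commutative monoid: $\mu\circ(\mu+\mathrm{id})=\mu\circ(\mathrm{id}+\mu)$, $\mu\circ(\eta+\mathrm{id})=\mathrm{id}$, $\mu\circ s=\mu$; - cocommutative comonoid: $(\delta+\mathrm{id})\circ\delta=(\mathrm{id}+\delta)\circ\delta$, $(\epsilon+\mathrm{id})\circ\delta=\mathrm{id}$, $s\circ\delta=\delta$; - Frobenius law: $(\mathrm{id}+\mu)\circ(\delta+\mathrm{id})=\delta\circ\mu=(\mu+\mathrm{id})\circ(\mathrm{id}+\delta)$; - special law: $\mu\circ\delta=\mathrm{id}$; - extra law: $\epsilon\circ\eta=\varnothing$. *)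

(* Defs.v *)
From HB Require Import structures.
From mathcomp Require Import all_boot.
From mathcomp Require Import boolp.

Set Implicit Arguments.
Unset Strict Implicit.
Unset Printing Implicit Defensive.

#[local] Obligation Tactic := idtac.

Declare Scope smc_scope.
Delimit Scope smc_scope with smc.
Local Open Scope smc_scope.

Reserved Notation "g ∘ f" (at level 40, left associativity).
Reserved Notation "f ⊗ g" (at level 35, right associativity).
Reserved Notation "a ⊠ b" (at level 35, right associativity).

Record smc_data := SmcData {
  obj :> Type;
  hom : obj -> obj -> Type;
  idm : forall a, hom a a;
  compm : forall a b c, hom b c -> hom a b -> hom a c;
  uobj : obj;
  tobj : obj -> obj -> obj;
  tensm : forall a b c d, hom a b -> hom c d -> hom (tobj a c) (tobj b d);
  assoc : forall a b c, hom (tobj (tobj a b) c) (tobj a (tobj b c));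
  assocV : forall a b c, hom (tobj a (tobj b c)) (tobj (tobj a b) c);
  lunit : forall a, hom (tobj uobj a) a;
  lunitV : forall a, hom a (tobj uobj a);
  runit : forall a, hom (tobj a uobj) a;
  runitV : forall a, hom a (tobj a uobj);
  braid : forall a b, hom (tobj a b) (tobj b a)
}.

Arguments hom {s}.
Arguments idm {s}.
Arguments compm {s a b c}.
Arguments uobj {s}.
Arguments tobj {s}.
Arguments tensm {s a b c d}.
Arguments assoc {s}.
Arguments assocV {s}.
Arguments lunit {s}.
Arguments lunitV {s}.
Arguments runit {s}.
Arguments runitV {s}.
Arguments braid {s}.

Notation "g ∘ f" := (compm g f) : smc_scope.
Notation "f ⊗ g" := (tensm f g) : smc_scope.
Notation "a ⊠ b" := (tobj a b) : smc_scope.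

Definition hom_rel (C : smc_data) :=
  forall a b : C, hom a b -> hom a b -> Prop.

(* The axioms are stated up to a relation on parallel morphisms: instantiated
   with equality they define symmetric monoidal categories, and the least
   congruence satisfying them is what "modulo the axioms of symmetric monoidal
   categories" means for formal terms. *)
Record smc_upto (C : smc_data) (E : hom_rel C) : Prop := SmcUpto {
  ax_compA : forall (a b c d : C) (f : hom a b) (g : hom b c) (h : hom c d),
    E _ _ (h ∘ (g ∘ f)) ((h ∘ g) ∘ f);
  ax_comp1m : forall (a b : C) (f : hom a b), E _ _ (idm b ∘ f) f;
  ax_compm1 : forall (a b : C) (f : hom a b), E _ _ (f ∘ idm a) f;
  ax_tens1 : forall a b : C, E _ _ (idm a ⊗ idm b) (idm (a ⊠ b));
  ax_tensM : forall (a b c a' b' c' : C) (f : hom a b) (g : hom b c)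
      (f' : hom a' b') (g' : hom b' c'),
    E _ _ ((g ∘ f) ⊗ (g' ∘ f')) ((g ⊗ g') ∘ (f ⊗ f'));
  ax_assocK : forall a b c : C, E _ _ (assocV a b c ∘ assoc a b c) (idm _);
  ax_assocVK : forall a b c : C, E _ _ (assoc a b c ∘ assocV a b c) (idm _);
  ax_lunitK : forall a : C, E _ _ (lunitV a ∘ lunit a) (idm _);
  ax_lunitVK : forall a : C, E _ _ (lunit a ∘ lunitV a) (idm _);
  ax_runitK : forall a : C, E _ _ (runitV a ∘ runit a) (idm _);
  ax_runitVK : forall a : C, E _ _ (runit a ∘ runitV a) (idm _);
  ax_assocN : forall (a b c a' b' c' : C)
      (f : hom a a') (g : hom b b') (h : hom c c'),
    E _ _ (assoc a' b' c' ∘ ((f ⊗ g) ⊗ h)) ((f ⊗ (g ⊗ h)) ∘ assoc a b c);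
  ax_lunitN : forall (a b : C) (f : hom a b),
    E _ _ (lunit b ∘ (idm uobj ⊗ f)) (f ∘ lunit a);
  ax_runitN : forall (a b : C) (f : hom a b),
    E _ _ (runit b ∘ (f ⊗ idm uobj)) (f ∘ runit a);
  ax_braidN : forall (a b a' b' : C) (f : hom a a') (g : hom b b'),
    E _ _ (braid a' b' ∘ (f ⊗ g)) ((g ⊗ f) ∘ braid a b);
  ax_braidK : forall a b : C, E _ _ (braid b a ∘ braid a b) (idm _);
  ax_triangle : forall a b : C,
    E _ _ ((idm a ⊗ lunit b) ∘ assoc a uobj b) (runit a ⊗ idm b);
  ax_pentagon : forall a b c d : C,
    E _ _ (assoc a b (c ⊠ d) ∘ assoc (a ⊠ b) c d)
          ((idm a ⊗ assoc b c d) ∘ (assoc a (b ⊠ c) d ∘ (assoc a b c ⊗ idm d)));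
  ax_braid_unit : forall a : C, E _ _ (lunit a ∘ braid a uobj) (runit a);
  ax_hexagon : forall a b c : C,
    E _ _ (assoc b c a ∘ (braid a (b ⊠ c) ∘ assoc a b c))
          ((idm b ⊗ braid a c) ∘ (assoc b a c ∘ (braid a b ⊗ idm c)))
}.

Definition eq_rel (C : smc_data) : hom_rel C := fun _ _ f g => f = g.

Record smcat := Smcat {
  smcat_data :> smc_data;
  smcatP : smc_upto (@eq_rel smcat_data)
}.

Section SmcatTheory.
Variable C : smcat.
Implicit Types a b c d : C.

Lemma compA a b c d (f : hom a b) (g : hom b c) (h : hom c d) :
  h ∘ (g ∘ f) = h ∘ g ∘ f.
Proof. exact: ax_compA (smcatP C) _ _ _ _ f g h. Qed.

Lemma comp1m a b (f : hom a b) : idm b ∘ f = f.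
Proof. exact: ax_comp1m (smcatP C) _ _ f. Qed.

Lemma compm1 a b (f : hom a b) : f ∘ idm a = f.
Proof. exact: ax_compm1 (smcatP C) _ _ f. Qed.

Lemma tens1 a b : idm a ⊗ idm b = idm (a ⊠ b).
Proof. exact: ax_tens1 (smcatP C) a b. Qed.

Lemma tensM a b c a' b' c' (f : hom a b) (g : hom b c)
    (f' : hom a' b') (g' : hom b' c') :
  (g ∘ f) ⊗ (g' ∘ f') = (g ⊗ g') ∘ (f ⊗ f').
Proof. exact: ax_tensM (smcatP C) _ _ _ _ _ _ f g f' g'. Qed.

Lemma tensMl a b c d (f : hom a b) (g : hom b c) :
  (g ∘ f) ⊗ idm d = (g ⊗ idm d) ∘ (f ⊗ idm d).
Proof. by rewrite -tensM comp1m. Qed.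

Lemma tensMr a b c d (f : hom a b) (g : hom b c) :
  idm d ⊗ (g ∘ f) = (idm d ⊗ g) ∘ (idm d ⊗ f).
Proof. by rewrite -tensM comp1m. Qed.

Definition is_iso a b (f : hom a b) :=
  exists g : hom b a, g ∘ f = idm a /\ f ∘ g = idm b.

Lemma is_iso_idm a : is_iso (idm a).
Proof. by exists (idm a); rewrite comp1m. Qed.

Lemma is_iso_comp a b c (f : hom a b) (g : hom b c) :
  is_iso f -> is_iso g -> is_iso (g ∘ f).
Proof.
move=> [f' [f'f ff']] [g' [g'g gg']]; exists (f' ∘ g'); split.
  by rewrite compA -(compA g) g'g compm1.
by rewrite compA -(compA f') ff' compm1.
Qed.

End SmcatTheory.

Record smfunctor (C D : smcat) := Smfunctor {
  fobj :> C -> D;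
  fmap : forall a b : C, hom a b -> hom (fobj a) (fobj b);
  fmu : forall a b : C, hom (fobj a ⊠ fobj b) (fobj (a ⊠ b));
  feps : hom uobj (fobj uobj);
  fmap1 : forall a : C, fmap (idm a) = idm (fobj a);
  fmapM : forall (a b c : C) (f : hom a b) (g : hom b c),
    fmap (g ∘ f) = fmap g ∘ fmap f;
  fmu_iso : forall a b : C, is_iso (fmu a b);
  feps_iso : is_iso feps;
  fmuN : forall (a b a' b' : C) (f : hom a a') (g : hom b b'),
    fmu a' b' ∘ (fmap f ⊗ fmap g) = fmap (f ⊗ g) ∘ fmu a b;
  fmu_assoc : forall a b c : C,
    fmap (assoc a b c) ∘ (fmu (a ⊠ b) c ∘ (fmu a b ⊗ idm (fobj c)))
    = fmu a (b ⊠ c) ∘ ((idm (fobj a) ⊗ fmu b c) ∘ assoc _ _ _);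
  fmu_lunit : forall a : C,
    fmap (lunit a) ∘ (fmu uobj a ∘ (feps ⊗ idm (fobj a))) = lunit (fobj a);
  fmu_runit : forall a : C,
    fmap (runit a) ∘ (fmu a uobj ∘ (idm (fobj a) ⊗ feps)) = runit (fobj a);
  fmu_braid : forall a b : C,
    fmap (braid a b) ∘ fmu a b = fmu b a ∘ braid (fobj a) (fobj b)
}.

Arguments fmap {C D} s {a b}.

Section SmfId.
Variable C : smcat.

Program Definition smf_id : smfunctor C C :=
  @Smfunctor C C id (fun _ _ f => f) (fun a b => idm (a ⊠ b)) (idm uobj)
    _ _ _ _ _ _ _ _ _.
Next Obligation. by []. Qed.
Next Obligation. by []. Qed.
Next Obligation. by move=> *; exact: is_iso_idm. Qed.
Next Obligation. by move=> *; exact: is_iso_idm. Qed.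
Next Obligation. move=> * /=; by rewrite comp1m compm1. Qed.
Next Obligation. move=> * /=; by rewrite !tens1 !comp1m !compm1. Qed.
Next Obligation. move=> * /=; by rewrite !tens1 !compm1. Qed.
Next Obligation. move=> * /=; by rewrite !tens1 !compm1. Qed.
Next Obligation. move=> * /=; by rewrite comp1m compm1. Qed.

End SmfId.

Section SmfComp.
Variables (A B C : smcat) (G : smfunctor B C) (F : smfunctor A B).

Lemma fmap_iso (a b : B) (f : hom a b) : is_iso f -> is_iso (fmap G f).
Proof.
by move=> [g [gf fg]]; exists (fmap G g); rewrite -!fmapM gf fg !fmap1.
Qed.

Program Definition smf_comp : smfunctor A C :=
  @Smfunctor A C (fun a => G (F a)) (fun _ _ f => fmap G (fmap F f))
    (fun a b => fmap G (fmu F a b) ∘ fmu G (F a) (F b))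
    (fmap G (feps F) ∘ feps G) _ _ _ _ _ _ _ _ _.
Next Obligation. move=> * /=; by rewrite !fmap1. Qed.
Next Obligation. move=> * /=; by rewrite !fmapM. Qed.
Next Obligation.
move=> * /=; apply: is_iso_comp; first exact: fmu_iso.
by apply: fmap_iso; exact: fmu_iso.
Qed.
Next Obligation.
move=> * /=; apply: is_iso_comp; first exact: feps_iso.
by apply: fmap_iso; exact: feps_iso.
Qed.
Next Obligation. move=> * /=; by rewrite -compA fmuN !compA -!fmapM fmuN. Qed.
Next Obligation.
move=> * /=; rewrite tensMl -(fmap1 G) -!compA.
rewrite (compA _ (fmap G _ ⊗ _) (fmu G _ _)) fmuN.
rewrite -!compA (compA _ (fmap G _) (fmap G _)) -fmapM.
rewrite (compA _ (fmap G _) (fmap G _)) -fmapM -?compA fmu_assoc.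
rewrite !fmapM -!compA fmap1 fmu_assoc; congr (_ ∘ _).
rewrite tensMr -(fmap1 G) -!compA !(compA _ (fmu G _ _) (fmap G _)) -fmuN.
by rewrite -!compA.
Qed.
Next Obligation.
move=> * /=; rewrite tensMl -(fmap1 G) -!compA.
rewrite (compA _ (fmap G _ ⊗ _) (fmu G _ _)) fmuN.
rewrite -!compA (compA _ (fmap G _) (fmap G _)) -fmapM.
rewrite (compA _ (fmap G _) (fmap G _)) -fmapM -?compA fmu_lunit.
by rewrite fmap1 fmu_lunit.
Qed.
Next Obligation.
move=> * /=; rewrite tensMr -(fmap1 G) -!compA.
rewrite (compA _ (_ ⊗ fmap G _) (fmu G _ _)) fmuN.
rewrite -!compA (compA _ (fmap G _) (fmap G _)) -fmapM.
rewrite (compA _ (fmap G _) (fmap G _)) -fmapM -?compA fmu_runit.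
by rewrite fmap1 fmu_runit.
Qed.
Next Obligation.
move=> * /=; by rewrite compA -fmapM fmu_braid fmapM -!compA fmu_braid.
Qed.

End SmfComp.

Definition monoidal_natiso (C D : smcat) (F G : smfunctor C D) : Prop :=
  exists t : forall a : C, hom (F a) (G a),
    [/\ forall a, is_iso (t a),
        forall (a b : C) (f : hom a b), t b ∘ fmap F f = fmap G f ∘ t a,
        forall a b : C, t (a ⊠ b) ∘ fmu F a b = fmu G a b ∘ (t a ⊗ t b)
      & t uobj ∘ feps F = feps G].

Definition sm_equivalent (C D : smcat) : Prop :=
  exists (F : smfunctor C D) (G : smfunctor D C),
    monoidal_natiso (smf_comp G F) (smf_id C) /\
    monoidal_natiso (smf_comp F G) (smf_id D).

Record prop_data := PropData {
  phom : nat -> nat -> Type;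
  pid : forall n, phom n n;
  pcomp : forall n m k, phom m k -> phom n m -> phom n k;
  psum : forall n m n' m', phom n m -> phom n' m' -> phom (n + n') (m + m');
  pbraid : forall n m, phom (n + m) (m + n)
}.

Arguments pid : clear implicits.
Arguments pcomp {p n m k}.
Arguments psum {p n m n' m'}.
Arguments pbraid : clear implicits.

(* The identity morphism of n, seen as a morphism n -> m along n = m. *)
Definition eqhom (P : prop_data) n m (e : n = m) : phom P n m :=
  match e in _ = k return phom P n k with erefl => pid P n end.

(* Strictness: addition on nat is associative and unital only up to
   propositional equality, so the associators and unitors are the identities
   transported along these equalities. *)
Definition smc_of_data (P : prop_data) : smc_data :=
  @SmcData nat (phom P) (pid P) (@pcomp P) 0 addn (@psum P)
    (fun a b c => eqhom P (esym (addnA a b c)))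
    (fun a b c => eqhom P (addnA a b c))
    (fun a => eqhom P (add0n a)) (fun a => eqhom P (esym (add0n a)))
    (fun a => eqhom P (addn0 a)) (fun a => eqhom P (esym (addn0 a)))
    (pbraid P).

Record prop := MkProp {
  prop_pdata :> prop_data;
  propP : smc_upto (@eq_rel (smc_of_data prop_pdata))
}.

Definition smc_of_prop (P : prop) : smcat := Smcat (propP P).

Record data_mor (P Q : prop_data) := DataMor {
  pmap :> forall n m, phom P n m -> phom Q n m;
  pmap1 : forall n, pmap (pid P n) = pid Q n;
  pmapM : forall n m k (f : phom P n m) (g : phom P m k),
    pmap (pcomp g f) = pcomp (pmap g) (pmap f);
  pmapD : forall n m n' m' (f : phom P n m) (g : phom P n' m'),
    pmap (psum f g) = psum (pmap f) (pmap g);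
  pmap_braid : forall n m, pmap (pbraid P n m) = pbraid Q n m
}.

Arguments pmap {P Q} d {n m}.

(* Identity-on-objects symmetric strict monoidal functors: being the identity
   on objects is built into the type of pmap, and the preservation of
   associators and unitors is pmap_eqhom. *)
Definition prop_mor (P Q : prop) := data_mor P Q.

Lemma pmap_eqhom (P Q : prop_data) (f : data_mor P Q) n m (e : n = m) :
  f _ _ (eqhom P e) = eqhom Q e.
Proof. by case: _ / e; rewrite pmap1. Qed.

Local Open Scope quotient_scope.

Record congruence (C : smc_data) (E : hom_rel C) : Prop := Congruence {
  cong_refl : forall (a b : C) (f : hom a b), E _ _ f f;
  cong_sym : forall (a b : C) (f g : hom a b), E _ _ f g -> E _ _ g f;
  cong_trans : forall (a b : C) (f g h : hom a b),
    E _ _ f g -> E _ _ g h -> E _ _ f h;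
  cong_comp : forall (a b c : C) (f f' : hom a b) (g g' : hom b c),
    E _ _ f f' -> E _ _ g g' -> E _ _ (g ∘ f) (g' ∘ f');
  cong_tens : forall (a b c d : C) (f f' : hom a b) (g g' : hom c d),
    E _ _ f f' -> E _ _ g g' -> E _ _ (f ⊗ g) (f' ⊗ g')
}.

Definition prop_rel (P : prop_data) := hom_rel (smc_of_data P).

Definition no_rel (P : prop_data) : prop_rel P := fun _ _ _ _ => False.

(* The least congruence that contains R and satisfies the axioms of symmetric
   strict monoidal categories. *)
Definition pcong (P : prop_data) (R : prop_rel P) : prop_rel P :=
  fun n m f g => forall E : prop_rel P,
    congruence E -> smc_upto E -> (forall n m f g, R n m f g -> E n m f g) ->
    E n m f g.

Section PropQuot.
Variables (P : prop_data) (R : prop_rel P).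

Lemma pcong_congruence : congruence (pcong R).
Proof.
split.
- by move=> a b f E cE _ _; apply: (cong_refl cE).
- by move=> a b f g fg E cE aE RE; apply: (cong_sym cE); apply: fg.
- move=> a b f g h fg gh E cE aE RE.
  by apply: (cong_trans cE (fg E cE aE RE)); apply: gh.
- move=> a b c f f' g g' ff' gg' E cE aE RE.
  by apply: (cong_comp cE); [apply: ff'|apply: gg'].
- move=> a b c d f f' g g' ff' gg' E cE aE RE.
  by apply: (cong_tens cE); [apply: ff'|apply: gg'].
Qed.

Lemma pcong_smc : smc_upto (pcong R).
Proof. by split=> * E cE aE RE; case: aE => *; auto. Qed.

Lemma pcong_base n m (f g : phom P n m) : R f g -> pcong R f g.
Proof. by move=> Rfg E cE aE RE; apply: RE. Qed.

Definition pcongb n m : rel {classic phom P n m} :=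
  fun f g => `[< pcong R f g >].

Lemma pcongb_refl n m : reflexive (@pcongb n m).
Proof. by move=> f; apply/asboolP; apply: (cong_refl pcong_congruence). Qed.

Lemma pcongb_sym n m : symmetric (@pcongb n m).
Proof.
by move=> f g; apply/asboolP/asboolP; apply: (cong_sym pcong_congruence).
Qed.

Lemma pcongb_trans n m : transitive (@pcongb n m).
Proof.
move=> g f h /asboolP fg /asboolP gh; apply/asboolP.
exact: (cong_trans pcong_congruence fg gh).
Qed.

Canonical pcong_equiv n m :=
  EquivRel (@pcongb n m) (@pcongb_refl n m) (@pcongb_sym n m)
    (@pcongb_trans n m).

Definition qhom n m : Type := {eq_quot pcong_equiv n m}.

Definition pclass n m (f : phom P n m) : qhom n m :=
  \pi_({eq_quot pcong_equiv n m}) (f : {classic phom P n m}).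
Definition prepr n m (q : qhom n m) : phom P n m :=
  repr (q : {eq_quot pcong_equiv n m}).

Lemma preprK n m (q : qhom n m) : pclass (prepr q) = q.
Proof. exact: reprK. Qed.

Lemma pclassP n m (f g : phom P n m) : pclass f = pclass g <-> pcong R f g.
Proof.
split=> [/eqmodP/asboolP //|fg].
by apply/eqmodP/asboolP.
Qed.

Definition qdata : prop_data :=
  @PropData qhom (fun n => pclass (pid P n))
    (fun n m k g f => pclass (pcomp (prepr g) (prepr f)))
    (fun n m n' m' f g => pclass (psum (prepr f) (prepr g)))
    (fun n m => pclass (pbraid P n m)).

Lemma pclass_comp n m k (f : phom P n m) (g : phom P m k) :
  pclass (pcomp g f) = @pcomp qdata _ _ _ (pclass g) (pclass f).
Proof.
apply/pclassP; apply: (cong_comp pcong_congruence); apply/pclassP;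
  by rewrite preprK.
Qed.

Lemma pclass_sum n m n' m' (f : phom P n m) (g : phom P n' m') :
  pclass (psum f g) = @psum qdata _ _ _ _ (pclass f) (pclass g).
Proof.
apply/pclassP; apply: (cong_tens pcong_congruence); apply/pclassP;
  by rewrite preprK.
Qed.

Definition pclass_mor : data_mor P qdata :=
  @DataMor P qdata pclass (fun _ => erefl) pclass_comp pclass_sum
    (fun _ _ => erefl).

Lemma smc_upto_image (Q : prop_data) (p : data_mor P Q)
    (r : forall n m, phom Q n m -> phom P n m) :
  (forall n m (x : phom Q n m), p _ _ (r _ _ x) = x) ->
  (forall n m (f g : phom P n m), pcong R f g -> p _ _ f = p _ _ g) ->
  smc_upto (@eq_rel (smc_of_data Q)).
Proof.
move=> rK pE; have [] := pcong_smc; rewrite /eq_rel /= => *; split => /=;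
  repeat (let f := fresh "f" in move=> f;
    try (match type of f with phom _ _ _ => rewrite -(rK _ _ f) end));
  rewrite -?(pmap_eqhom p) -?(pmap1 p) -?(pmap_braid p) -?(pmapM, pmapD);
  apply: pE; auto.
Qed.

Lemma qdataP : smc_upto (@eq_rel (smc_of_data qdata)).
Proof.
by apply: (smc_upto_image (p := pclass_mor)) preprK _ => n m f g /pclassP.
Qed.

Definition quot_prop : prop := MkProp qdataP.

Section Lift.
Variables (Q : prop) (f : data_mor P Q).
Hypothesis Rf : forall n m (x y : phom P n m), R x y -> f _ _ x = f _ _ y.

Lemma pcong_lift n m (x y : phom P n m) : pcong R x y -> f _ _ x = f _ _ y.
Proof.
move=> /(_ (fun n m x y => f n m x = f n m y)); apply => //.
  split=> //= [a b x' y' z -> //|a b c x1 y1 x2 y2 e1 e2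
               |a b c d x1 y1 x2 y2 e1 e2].
    by rewrite !pmapM e1 e2.
  by rewrite !pmapD e1 e2.
have [] := propP Q; rewrite /eq_rel /= => *; split => /= *;
  rewrite ?(pmapM, pmapD, pmap1, pmap_eqhom, pmap_braid); auto.
Qed.

Definition quot_lift : prop_mor quot_prop Q.
Proof.
exists (fun n m q => f n m (prepr q)) => /=.
- move=> n; rewrite -(pmap1 f); apply: pcong_lift.
  by apply/pclassP; rewrite preprK.
- move=> n m k x y; rewrite -(pmapM f); apply: pcong_lift.
  by apply/pclassP; rewrite preprK.
- move=> n m n' m' x y; rewrite -(pmapD f); apply: pcong_lift.
  by apply/pclassP; rewrite preprK.
- move=> n m; rewrite -(pmap_braid f); apply: pcong_lift.
  by apply/pclassP; rewrite preprK.
Defined.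

Lemma quot_liftE n m (x : phom P n m) : quot_lift _ _ (pclass x) = f _ _ x.
Proof. by apply: pcong_lift; apply/pclassP; rewrite preprK. Qed.

End Lift.

End PropQuot.

Definition signature := nat -> nat -> Type.

Inductive term (S : signature) : nat -> nat -> Type :=
| Tempty : term S 0 0
| Tid : term S 1 1
| Tswap : term S 2 2
| Tgen n m : S n m -> term S n m
| Tcomp n m k : term S m k -> term S n m -> term S n k
| Tsum n m n' m' : term S n m -> term S n' m' -> term S (n + n') (m + m').

Arguments Tempty {S}.
Arguments Tid {S}.
Arguments Tswap {S}.

Section Terms.
Variable S : signature.

(* The axioms of symmetric strict monoidal categories mention identities and
   braidings on all objects: as terms, these are built from the ones on 1 as
   the hexagon equations prescribe (see teval_id and teval_braid). *)
Fixpoint tid n : term S n n :=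
  if n is n'.+1 then Tsum Tid (tid n') else Tempty.

Definition teq n m (e : n = m) : term S n m :=
  match e in _ = k return term S n k with erefl => tid n end.

(* The braiding 1 + m -> m + 1. *)
Fixpoint tbraid1 m : term S (1 + m) (m + 1) :=
  if m is m'.+1 then Tcomp (Tsum Tid (tbraid1 m')) (Tsum Tswap (tid m'))
  else Tid.

Fixpoint tbraid n m : term S (n + m) (m + n) :=
  if n is n'.+1 then
    Tcomp (teq (esym (addnA m 1 n')))
      (Tcomp (Tsum (tbraid1 m) (tid n')) (Tsum Tid (tbraid n' m)))
  else teq (esym (addn0 m)).

Definition term_data : prop_data :=
  @PropData (term S) tid (@Tcomp S) (@Tsum S) tbraid.

Definition free_prop : prop := quot_prop (@no_rel term_data).

Definition term_class n m (t : term S n m) : phom free_prop n m :=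
  @pclass term_data _ n m t.

Definition free_gen n m (s : S n m) : phom free_prop n m :=
  term_class (Tgen s).

End Terms.

Section PropTheory.
Variable P : prop.
Local Notation C := (smc_of_prop P).

Lemma pcompA n m k l (f : phom P n m) (g : phom P m k) (h : phom P k l) :
  pcomp h (pcomp g f) = pcomp (pcomp h g) f.
Proof. exact: (@compA C _ _ _ _ f g h). Qed.

Lemma pcomp1m n m (f : phom P n m) : pcomp (pid P m) f = f.
Proof. exact: (@comp1m C _ _ f). Qed.

Lemma pcompm1 n m (f : phom P n m) : pcomp f (pid P n) = f.
Proof. exact: (@compm1 C _ _ f). Qed.

Lemma psum1 n m : psum (pid P n) (pid P m) = pid P (n + m).
Proof. exact: (@tens1 C n m). Qed.

Lemma psumM n m k n' m' k' (f : phom P n m) (g : phom P m k)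
    (f' : phom P n' m') (g' : phom P m' k') :
  psum (pcomp g f) (pcomp g' f') = pcomp (psum g g') (psum f f').
Proof. exact: (@tensM C _ _ _ _ _ _ f g f' g'). Qed.

Lemma eqhom_id n (e : n = n) : eqhom P e = pid P n.
Proof. by rewrite (eq_irrelevance e erefl). Qed.

Lemma eqhomM n m k (e : n = m) (e' : m = k) :
  pcomp (eqhom P e') (eqhom P e) = eqhom P (etrans e e').
Proof. by case: _ / e'; rewrite pcomp1m. Qed.

Lemma eqhomK n m (e : n = m) (e' : m = n) :
  pcomp (eqhom P e') (eqhom P e) = pid P n.
Proof. by rewrite eqhomM eqhom_id. Qed.

Lemma pbraidK n m : pcomp (pbraid P m n) (pbraid P n m) = pid P _.
Proof. exact: (ax_braidK (propP P) n m). Qed.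

Lemma pbraidn0 n :
  pbraid P n 0 = eqhom P (etrans (addn0 n) (esym (add0n n))).
Proof.
have /= := ax_braid_unit (propP P) n; rewrite /eq_rel /= => e.
rewrite -eqhomM -e pcompA eqhomK; exact/esym/pcomp1m.
Qed.

Lemma pbraid0n n :
  pbraid P 0 n = eqhom P (etrans (add0n n) (esym (addn0 n))).
Proof.
rewrite -[LHS]pcomp1m.
rewrite -(@eqhomK (n + 0) n (etrans (addn0 n) (esym (add0n n)))
                    (etrans (add0n n) (esym (addn0 n)))).
by rewrite -pbraidn0 -pcompA pbraidK pcompm1.
Qed.

Lemma pbraidnD a b c :
  pbraid P a (b + c) =
  pcomp (eqhom P (addnA b c a))
    (pcomp (psum (pid P b) (pbraid P a c))
      (pcomp (eqhom P (esym (addnA b a c)))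
        (pcomp (psum (pbraid P a b) (pid P c)) (eqhom P (addnA a b c))))).
Proof.
have /= := ax_hexagon (propP P) a b c; rewrite /eq_rel /= => e.
have {}e := congr1 (fun f => pcomp (eqhom P (addnA b c a))
  (pcomp f (eqhom P (addnA a b c)))) e.
move: e; rewrite -!pcompA eqhomK pcompm1 pcompA eqhomK pcomp1m => ->.
by [].
Qed.

Lemma pbraidDn a b c :
  pbraid P (b + c) a =
  pcomp (eqhom P (esym (addnA a b c)))
    (pcomp (psum (pbraid P b a) (pid P c))
      (pcomp (eqhom P (addnA b a c))
        (pcomp (psum (pid P b) (pbraid P c a)) (eqhom P (esym (addnA b c a)))))).
Proof.
rewrite -[RHS]pcompm1 -(pbraidK (b + c) a) pbraidnD.
set f := pbraid P (b + c) a.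
have K2 : pcomp (psum (pid P b) (pbraid P c a)) (psum (pid P b) (pbraid P a c))
   = pid P _ by rewrite -psumM pcomp1m pbraidK psum1.
have K1 : pcomp (psum (pbraid P b a) (pid P c)) (psum (pbraid P a b) (pid P c))
   = pid P _ by rewrite -psumM pcomp1m pbraidK psum1.
rewrite -!pcompA (pcompA _ (eqhom P (addnA b c a))) eqhomK pcomp1m.
rewrite (pcompA _ (psum (pid P b) (pbraid P a c))) K2 pcomp1m.
rewrite (pcompA _ (eqhom P (esym (addnA b a c)))) eqhomK pcomp1m.
rewrite (pcompA _ (psum (pbraid P a b) _)) K1 pcomp1m.
by rewrite pcompA eqhomK pcomp1m.
Qed.

End PropTheory.

Section FreeExtension.
Variables (S : signature) (P : prop) (v : forall n m, S n m -> phom P n m).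

Fixpoint teval n m (t : term S n m) : phom P n m :=
  match t in term _ n m return phom P n m with
  | Tempty => pid P 0
  | Tid => pid P 1
  | Tswap => pbraid P 1 1
  | Tgen _ _ s => v s
  | Tcomp _ _ _ g f => pcomp (teval g) (teval f)
  | Tsum _ _ _ _ f g => psum (teval f) (teval g)
  end.

Lemma teval_id n : teval (tid S n) = pid P n.
Proof. by elim: n => //= n ->; exact: (@psum1 P 1 n). Qed.

Lemma teval_eq n m (e : n = m) : teval (teq S e) = eqhom P e.
Proof. by case: _ / e; apply: teval_id. Qed.

Lemma teval_braid1 m : teval (tbraid1 S m) = pbraid P 1 m.
Proof.
elim: m => [|m IHm] /=; first by rewrite pbraidn0 eqhom_id.
rewrite IHm teval_id (@pbraidnD P 1 1 m).
rewrite (@eqhom_id P ((1 + 1) + m) (addnA 1 1 m)).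
rewrite (@eqhom_id P (1 + (1 + m)) (esym (addnA 1 1 m))).
rewrite (@eqhom_id P (1 + (m + 1)) (addnA 1 m 1)).
by rewrite !(pcomp1m, pcompm1).
Qed.

Lemma teval_braid n m : teval (tbraid S n m) = pbraid P n m.
Proof.
elim: n => [|n IHn]; last first.
  rewrite (@pbraidDn P m 1 n) /= teval_eq teval_braid1 teval_id IHn.
  rewrite (@eqhom_id P ((1 + m) + n) (addnA 1 m n)).
  rewrite (@eqhom_id P (1 + (n + m)) (esym (addnA 1 n m))).
  by rewrite !(pcomp1m, pcompm1).
by rewrite /= teval_eq pbraid0n; congr eqhom; apply: eq_irrelevance.
Qed.

Definition teval_mor : data_mor (term_data S) P :=
  @DataMor (term_data S) P teval teval_id
    (fun _ _ _ _ _ => erefl) (fun _ _ _ _ _ _ => erefl) teval_braid.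

Definition free_ext : prop_mor (free_prop S) P :=
  @quot_lift _ _ P teval_mor (fun _ _ _ _ => @False_ind _).

Lemma free_ext_class n m (t : term S n m) :
  free_ext _ _ (term_class t) = teval t.
Proof. exact: quot_liftE. Qed.

Lemma free_ext_gen n m (s : S n m) : free_ext _ _ (free_gen s) = v s.
Proof. exact: free_ext_class. Qed.

End FreeExtension.

Lemma psum_pid0 (P : prop) n m (f : phom P n m) :
  pcomp (eqhom P (addn0 m)) (psum f (pid P 0)) = pcomp f (eqhom P (addn0 n)).
Proof. exact: (ax_runitN (propP P) f). Qed.

Section FreeUniversal.
Variable S : signature.
Local Notation F := (free_prop S).

Lemma term_class_comp n m k (f : term S n m) (g : term S m k) :
  term_class (Tcomp g f) = pcomp (term_class g) (term_class f).
Proof. exact: (@pclass_comp (term_data S)). Qed.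

Lemma term_class_sum n m n' m' (f : term S n m) (g : term S n' m') :
  term_class (Tsum f g) = psum (term_class f) (term_class g).
Proof. exact: (@pclass_sum (term_data S)). Qed.

Lemma term_class_eq n m (e : n = m) : term_class (teq S e) = eqhom F e.
Proof. by case: _ / e. Qed.

Lemma term_class_Tid : @term_class S _ _ Tid = pid F 1.
Proof.
have := psum_pid0 (@term_class S _ _ Tid).
rewrite !(@eqhom_id F 1) pcomp1m pcompm1 => <-.
exact: (esym (term_class_sum Tid Tempty)).
Qed.

Lemma term_class_Tswap : @term_class S _ _ Tswap = pbraid F 1 1.
Proof.
have := psum_pid0 (@term_class S _ _ Tswap).
rewrite !(@eqhom_id F 2) pcomp1m pcompm1 => e.
have e2 : @term_class S 2 2 (tbraid1 S 1) = term_class Tswap.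
  rewrite /= term_class_comp (term_class_sum Tid Tid) term_class_Tid.
  rewrite (@psum1 F 1 1) (@pcomp1m F).
  by rewrite (term_class_sum Tswap Tempty).
have -> : pbraid F 1 1 = term_class (tbraid S 1 1) by [].
rewrite [tbraid S 1 1]/= !term_class_comp !term_class_eq.
rewrite (@eqhom_id F 2) (@pcomp1m F) (term_class_sum (tbraid1 S 1) Tempty).
rewrite (term_class_sum Tid (teq S _)) e2 term_class_Tid term_class_eq.
rewrite (@eqhom_id F 1) (@psum1 F 1 1) (@pcompm1 F).
exact: (esym e).
Qed.

Lemma free_ext_uniq (P : prop) (f g : prop_mor F P) :
  (forall n m (s : S n m), f _ _ (free_gen s) = g _ _ (free_gen s)) ->
  forall n m (x : phom F n m), f _ _ x = g _ _ x.
Proof.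
move=> fg n m x; rewrite -(preprK x); move: (prepr x) => {x} t.
rewrite -/(term_class t); elim: t => {n m} /=.
- by rewrite (pmap1 f 0) (pmap1 g 0).
- by rewrite term_class_Tid !pmap1.
- rewrite term_class_Tswap.
  exact: etrans (pmap_braid f 1 1) (esym (pmap_braid g 1 1)).
- exact: fg.
- by move=> n m k x ex y ey; rewrite term_class_comp !pmapM ex ey.
- by move=> n m n' m' x ex y ey; rewrite term_class_sum !pmapD ex ey.
Qed.

End FreeUniversal.

Section Coequalizer.
Variables (P Q : prop) (f g : prop_mor P Q).

Definition coeq_rel : prop_rel Q :=
  fun n m x y => exists z : phom P n m, x = f n m z /\ y = g n m z.

Definition coeq_prop : prop := quot_prop coeq_rel.

Definition coeq_proj : prop_mor Q coeq_prop := pclass_mor coeq_rel.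

Lemma coeq_projE n m (z : phom P n m) :
  coeq_proj _ _ (f _ _ z) = coeq_proj _ _ (g _ _ z).
Proof. by apply/pclassP; apply: pcong_base; exists z. Qed.

Lemma coeq_universal (T : prop) (h : prop_mor Q T) :
  (forall n m (z : phom P n m), h _ _ (f _ _ z) = h _ _ (g _ _ z)) ->
  exists k : prop_mor coeq_prop T,
    (forall n m (x : phom Q n m), k _ _ (coeq_proj _ _ x) = h _ _ x) /\
    (forall k' : prop_mor coeq_prop T,
      (forall n m (x : phom Q n m), k' _ _ (coeq_proj _ _ x) = h _ _ x) ->
      forall n m (y : phom coeq_prop n m), k' _ _ y = k _ _ y).
Proof.
move=> hfg; have hR n m (x y : phom Q n m) : coeq_rel x y -> h _ _ x = h _ _ y.
  by case=> z [-> ->].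
exists (quot_lift hR); split=> [n m x|k' k'E n m y]; first exact: quot_liftE.
by rewrite -(preprK y) quot_liftE; apply: k'E.
Qed.

End Coequalizer.

Record theory := Theory {
  tsig : signature;
  teqn : forall n m, term tsig n m -> term tsig n m -> Prop
}.

Section TheoryProp.
Variable T : theory.

Definition eqn_sig : signature :=
  fun n m => {p : term (tsig T) n m * term (tsig T) n m | teqn p.1 p.2}.

Definition eqn_lhs : prop_mor (free_prop eqn_sig) (free_prop (tsig T)) :=
  free_ext (fun n m (e : eqn_sig n m) => term_class (sval e).1).

Definition eqn_rhs : prop_mor (free_prop eqn_sig) (free_prop (tsig T)) :=
  free_ext (fun n m (e : eqn_sig n m) => term_class (sval e).2).

Definition theory_prop : prop := coeq_prop eqn_lhs eqn_rhs.

End TheoryProp.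

Inductive escfm_gen : nat -> nat -> Set :=
| gen_mu : escfm_gen 2 1
| gen_eta : escfm_gen 0 1
| gen_delta : escfm_gen 1 2
| gen_eps : escfm_gen 1 0.

Definition escfm_sig : signature := escfm_gen.

Section ESCFM.

Local Notation T := (term escfm_sig).
Local Notation mu := (@Tgen escfm_sig _ _ gen_mu).
Local Notation eta := (@Tgen escfm_sig _ _ gen_eta).
Local Notation delta := (@Tgen escfm_sig _ _ gen_delta).
Local Notation eps := (@Tgen escfm_sig _ _ gen_eps).
Local Notation "g ∘ f" := (Tcomp g f).
Local Notation "f + g" := (Tsum f g).

Inductive escfm_eqn : forall n m, T n m -> T n m -> Prop :=
| eqn_mul_assoc : @escfm_eqn 3 1 (mu ∘ (mu + Tid)) (mu ∘ (Tid + mu))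
| eqn_mul_unit : @escfm_eqn 1 1 (mu ∘ (eta + Tid)) Tid
| eqn_mul_comm : @escfm_eqn 2 1 (mu ∘ Tswap) mu
| eqn_comul_assoc :
    @escfm_eqn 1 3 ((delta + Tid) ∘ delta) ((Tid + delta) ∘ delta)
| eqn_comul_unit : @escfm_eqn 1 1 ((eps + Tid) ∘ delta) Tid
| eqn_comul_comm : @escfm_eqn 1 2 (Tswap ∘ delta) delta
| eqn_frobl : @escfm_eqn 2 2 ((Tid + mu) ∘ (delta + Tid)) (delta ∘ mu)
| eqn_frobr : @escfm_eqn 2 2 (delta ∘ mu) ((mu + Tid) ∘ (Tid + delta))
| eqn_special : @escfm_eqn 1 1 (mu ∘ delta) Tid
| eqn_extra : @escfm_eqn 0 0 (eps ∘ eta) Tempty.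

End ESCFM.

Definition escfm : theory := Theory escfm_eqn.

Definition Th_ESCFM : prop := theory_prop escfm.

Definition corel (X Y : finType) : Type :=
  {P : {set {set X + Y}} | partition P [set: X + Y]}.

Definition refines (T : finType) (P Q : {set {set T}}) : bool :=
  [forall B in P, exists C in Q, B \subset C].

(* The restriction of the partition P along (an injection) i. *)
Definition restrict (S T : finType) (i : S -> T) (P : {set {set T}}) :
    {set {set S}} :=
  preim_partition (fun x => pblock P (i x)) [set: S].

Section Composition.
Variables X Y Z : finType.

Definition inXY (u : X + Y) : X + Y + Z := inl u.

Definition inYZ (u : Y + Z) : X + Y + Z :=
  match u with inl y => inl (inr y) | inr z => inr z end.

Definition inXZ (u : X + Z) : X + Y + Z :=
  match u with inl x => inl (inl x) | inr z => inr z end.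

Definition glued (a : {set {set X + Y}}) (b : {set {set Y + Z}})
    (P : {set {set X + Y + Z}}) : bool :=
  [&& partition P [set: X + Y + Z], refines a (restrict inXY P)
    & refines b (restrict inYZ P)].

(* Two elements are in the same class of the finest glued partition when they
   are in the same class of every glued partition. *)
Definition finest_glued (a : {set {set X + Y}}) (b : {set {set Y + Z}}) :
    {set {set X + Y + Z}} :=
  equivalence_partition
    (fun u v => [forall P, glued a b P ==> (v \in pblock P u)])
    [set: X + Y + Z].

End Composition.

Section PartitionFacts.
Variable T : finType.
Implicit Types P Q : {set {set T}}.

Lemma mem_pblockT P x : partition P [set: T] -> x \in pblock P x.
Proof. by case/and3P=> /eqP covP _ _; rewrite mem_pblock covP. Qed.

Lemma pblock_equiv P : partition P [set: T] ->
  equivalence_rel (fun x y => y \in pblock P x).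
Proof. by move=> pP x y z; apply: (pblock_equivalence pP). Qed.

Lemma eq_pblockT P x y : partition P [set: T] ->
  (pblock P x == pblock P y) = (y \in pblock P x).
Proof.
by case/and3P=> /eqP covP tP _; rewrite eq_pblock // covP.
Qed.

Lemma partition_ext P Q : partition P [set: T] -> partition Q [set: T] ->
  (forall x y, (y \in pblock P x) = (y \in pblock Q x)) -> P = Q.
Proof.
move=> pP pQ PQ.
rewrite -(equivalence_partition_pblock pP) -(equivalence_partition_pblock pQ).
apply: eq_in_imset => x _; apply/setP => y; by rewrite !inE PQ.
Qed.

Lemma pblock_preim (I : eqType) (f : T -> I) x y :
  (y \in pblock (preim_partition f [set: T]) x) = (f x == f y).
Proof.
rewrite pblock_equivalence_partition ?inE //.
by split=> // /eqP ->.
Qed.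

Lemma refinesP P Q : partition P [set: T] -> partition Q [set: T] ->
  reflect (forall x y, y \in pblock P x -> y \in pblock Q x) (refines P Q).
Proof.
move=> pP pQ; have [/eqP covP tP _] := and3P pP; have [_ tQ Q0] := and3P pQ.
apply: (iffP forall_inP) => [PQ x y xy|PQ B PB].
  have /PQ/exists_inP[C QC /subsetP BC] : pblock P x \in P.
    by rewrite pblock_mem // covP.
  by rewrite (def_pblock tQ QC (BC _ (mem_pblockT x pP))) BC.
have /set0Pn[x Bx] : B != set0.
  by apply: contraNneq (_ : set0 \notin P) => [<- //|]; case/and3P: pP.
apply/exists_inP; exists (pblock Q x).
  by rewrite pblock_mem //; case/and3P: pQ => /eqP ->.
by apply/subsetP => y By; apply: PQ; rewrite (def_pblock tP PB Bx).
Qed.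

End PartitionFacts.

Lemma restrict_partition (S T : finType) (i : S -> T) P :
  partition (restrict i P) [set: S].
Proof. exact: preim_partitionP. Qed.

Lemma pblock_restrict (S T : finType) (i : S -> T) P x y :
  partition P [set: T] ->
  (y \in pblock (restrict i P) x) = (i y \in pblock P (i x)).
Proof. by move=> pP; rewrite pblock_preim eq_pblockT. Qed.

Section FinestGlued.
Variables (X Y Z : finType) (a : corel X Y) (b : corel Y Z).
Local Notation a' := (sval a).
Local Notation b' := (sval b).

Lemma gluedP P :
  reflect [/\ partition P [set: X + Y + Z],
              forall u v, v \in pblock a' u -> inXY Z v \in pblock P (inXY Z u)
            & forall u v, v \in pblock b' u -> inYZ X v \in pblock P (inYZ X u)]
          (glued a' b' P).
Proof.
apply: (iffP and3P) => -[pP aP bP]; split=> //.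
- move=> u v uv; rewrite -pblock_restrict //; move: u v uv.
  by apply/refinesP => //; [exact: (svalP a)|exact: restrict_partition].
- move=> u v uv; rewrite -pblock_restrict //; move: u v uv.
  by apply/refinesP => //; [exact: (svalP b)|exact: restrict_partition].
- apply/refinesP => [||u v uv]; [exact: (svalP a)|exact: restrict_partition|].
  by rewrite pblock_restrict //; apply: aP.
- apply/refinesP => [||u v uv]; [exact: (svalP b)|exact: restrict_partition|].
  by rewrite pblock_restrict //; apply: bP.
Qed.

Lemma glue_equiv : equivalence_rel (fun u v : X + Y + Z =>
  [forall P, glued a' b' P ==> (v \in pblock P u)]).
Proof.
move=> u v w; split.
  by apply/forall_inP => P /gluedP[pP _ _]; apply: mem_pblockT.
move=> /forall_inP uv; apply/forall_inP/forall_inP => uw P gP;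
  have [pP _ _] := gluedP _ gP; have [_ e] := pblock_equiv pP u v w.
  by rewrite -e ?uw ?uv.
by rewrite e ?uw ?uv.
Qed.

Lemma finest_glued_partition : partition (finest_glued a' b') [set: X + Y + Z].
Proof. by apply: equivalence_partitionP => u v w _ _ _; apply: glue_equiv. Qed.

Lemma pblock_finest u v :
  reflect (forall P, glued a' b' P -> v \in pblock P u)
          (v \in pblock (finest_glued a' b') u).
Proof.
rewrite pblock_equivalence_partition ?inE //; first exact: forall_inP.
by move=> ? ? ? _ _ _; apply: glue_equiv.
Qed.

Lemma finest_glued_glued : glued a' b' (finest_glued a' b').
Proof.
apply/gluedP; split=> [|u v uv|u v uv]; first exact: finest_glued_partition.
- by apply/pblock_finest => P /gluedP[_ aP _]; apply: aP.
- by apply/pblock_finest => P /gluedP[_ _ bP]; apply: bP.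
Qed.

Lemma finest_glued_finest P : glued a' b' P -> refines (finest_glued a' b') P.
Proof.
move=> gP; apply/refinesP => [||u v /pblock_finest]; last exact.
  exact: finest_glued_partition.
by case/gluedP: gP.
Qed.

Definition corel_comp : corel X Z :=
  exist _ (restrict (@inXZ X Y Z) (finest_glued a' b'))
    (restrict_partition _ _).

End FinestGlued.

Lemma corel_bij_subproof (X Y : finType) (f : X -> Y) : bijective f ->
  partition [set [set inl x; inr (f x)] | x : X] [set: X + Y].
Proof.
case=> g fK gK; apply/and3P; split.
- apply/eqP/setP => u; rewrite in_setT; apply/bigcupP.
  case: u => [x|y].
    exists [set inl x; inr (f x)]; first by apply/imsetP; exists x.
    by rewrite !inE eqxx.
  exists [set inl (g y); inr (f (g y))]; first by apply/imsetP; exists (g y).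
  by rewrite gK !inE eqxx orbT.
- apply/trivIsetP => _ _ /imsetP[x _ ->] /imsetP[x' _ ->] ne.
  rewrite -setI_eq0; apply: contraNT ne => /set0Pn[u].
  rewrite !inE => /andP[/orP[]/eqP -> /orP[]/eqP //] => -[].
    by move=> ->.
  by move=> /(can_inj fK) ->.
- by apply/imsetP => -[x _ /setP/(_ (inl x))]; rewrite !inE eqxx.
Qed.

Definition corel_bij (X Y : finType) (f : X -> Y) (bf : bijective f) :
    corel X Y :=
  exist _ [set [set inl x; inr (f x)] | x : X] (corel_bij_subproof bf).

Lemma id_bij (X : finType) : bijective (@id X).
Proof. by exists id. Qed.

Definition corel_id (X : finType) : corel X X := corel_bij (id_bij X).

Section Sum.
Variables X Y X' Y' : finType.

Definition sum_inl (u : X + Y) : (X + X') + (Y + Y') :=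
  match u with inl x => inl (inl x) | inr y => inr (inl y) end.

Definition sum_inr (u : X' + Y') : (X + X') + (Y + Y') :=
  match u with inl x => inl (inr x) | inr y => inr (inr y) end.

Lemma sum_inl_inj : injective sum_inl.
Proof. by case=> [x|y] [x'|y'] //= [->]. Qed.

Lemma sum_inr_inj : injective sum_inr.
Proof. by case=> [x|y] [x'|y'] //= [->]. Qed.

Variables (a : corel X Y) (b : corel X' Y').

Definition corel_sum_set : {set {set (X + X') + (Y + Y')}} :=
  [set sum_inl @: A | A : {set X + Y} in sval a] :|:
  [set sum_inr @: B | B : {set X' + Y'} in sval b].

Lemma sum_inlr u v : sum_inl u <> sum_inr v.
Proof. by case: u v => [x|y] [x'|y']. Qed.

Lemma imset_disj (T U : finType) (f : T -> U) (A B : {set T}) :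
  injective f -> f @: A != f @: B -> (A != B -> [disjoint A & B]) ->
  [disjoint f @: A & f @: B].
Proof.
move=> fI ne AB; have {}ne : A != B by apply: contraNneq ne => ->.
by rewrite imset_disjoint ?AB.
Qed.

Lemma corel_sum_subproof :
  partition corel_sum_set [set: (X + X') + (Y + Y')].
Proof.
have [/eqP cova /trivIsetP ta a0] := and3P (svalP a).
have [/eqP covb /trivIsetP tb b0] := and3P (svalP b).
apply/and3P; split.
- have La (u : X + Y) : sum_inl u \in cover corel_sum_set.
    apply/bigcupP; exists (sum_inl @: pblock (sval a) u).
      by rewrite inE imset_f // pblock_mem // cova.
    by rewrite imset_f // mem_pblock cova.
  have Lb (u : X' + Y') : sum_inr u \in cover corel_sum_set.
    apply/bigcupP; exists (sum_inr @: pblock (sval b) u).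
      by rewrite inE orbC imset_f // pblock_mem // covb.
    by rewrite imset_f // mem_pblock covb.
  apply/eqP/setP => u; rewrite in_setT.
  by case: u => [[x|x]|[y|y]];
    [exact: (La (inl x))|exact: (Lb (inl x))
    |exact: (La (inr y))|exact: (Lb (inr y))].
- apply/trivIsetP => A B.
  have dis (C : {set X + Y}) (D : {set X' + Y'}) :
      [disjoint sum_inl @: C & sum_inr @: D].
    apply/pred0P => u /=; apply: contraTF isT => /andP[].
    by case/imsetP=> c _ -> /imsetP[d _ /sum_inlr].
  rewrite !inE => /orP[]/imsetP[A' PA ->] /orP[]/imsetP[B' PB ->] ne //.
  + by apply: imset_disj (sum_inl_inj) ne _ => ne; apply: ta.
  + by rewrite disjoint_sym.
  + by apply: imset_disj (sum_inr_inj) ne _ => ne; apply: tb.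
- rewrite inE negb_or; apply/andP; split.
  + by apply: contra a0 => /imsetP[A PA /esym/eqP]; rewrite imset_eq0 => /eqP <-.
  + by apply: contra b0 => /imsetP[A PA /esym/eqP]; rewrite imset_eq0 => /eqP <-.
Qed.

Definition corel_sum : corel (X + X')%type (Y + Y')%type :=
  exist _ corel_sum_set corel_sum_subproof.

End Sum.

(* The labelings of X + Y that are constant on the classes of a corelation
   determine it, and turn composition into composition of relations; all the
   axioms of Corel are proved through them. *)

Definition copair (X Y T : Type) (f : X -> T) (g : Y -> T) (u : X + Y) : T :=
  match u with inl x => f x | inr y => g y end.

Definition compat (X Y : finType) (a : corel X Y) (f : X -> bool)
    (g : Y -> bool) : Prop :=
  forall u v, v \in pblock (sval a) u -> copair f g u = copair f g v.

Lemma pblockP (T : finType) (P : {set {set T}}) u v : partition P [set: T] ->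
  reflect (exists2 B : {set T}, B \in P & u \in B /\ v \in B)
          (v \in pblock P u).
Proof.
move=> pP; have [/eqP covP tP _] := and3P pP.
apply: (iffP idP) => [uv|[B PB [uB vB]]]; last by rewrite (def_pblock tP PB uB).
exists (pblock P u); first by rewrite pblock_mem // covP.
by rewrite mem_pblockT.
Qed.

Lemma corel_ext (X Y : finType) (a b : corel X Y) :
  (forall f g, compat a f g <-> compat b f g) -> a = b.
Proof.
have sub (c d : corel X Y) : (forall f g, compat c f g -> compat d f g) ->
    forall u v, v \in pblock (sval d) u -> v \in pblock (sval c) u.
  move=> cd u v uv.
  pose h w := w \in pblock (sval c) u.
  have hE w : copair (h \o inl) (h \o inr) w = h w by case: w.
  have /cd/(_ u v uv) : compat c (h \o inl) (h \o inr).
    move=> w w' ww'; rewrite !hE /h.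
    rewrite -!(eq_pblockT _ _ (svalP c)) in ww' *.
    by rewrite (eqP ww').
  by rewrite !hE /h mem_pblockT ?(svalP c) // => <-.
move=> ab; suff : sval a = sval b.
  case: a b {ab} => [A pA] [B pB] /= e; subst B.
  by rewrite (bool_irrelevance pA pB).
apply: (partition_ext (svalP a) (svalP b)) => u v.
by apply/idP/idP; apply: sub => f g; apply ab.
Qed.

Lemma compat_comp (X Y Z : finType) (a : corel X Y) (b : corel Y Z) f h :
  compat (corel_comp a b) f h <-> exists g, compat a f g /\ compat b g h.
Proof.
have pF := finest_glued_partition a b.
split=> [fh|[g [fg gh]] u v]; last first.
  rewrite pblock_restrict // => /pblock_finest uv.
  pose l := copair (copair f g) h.
  have /uv : glued (sval a) (sval b) (preim_partition l [set: _]).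
    apply/gluedP; split; first exact: preim_partitionP.
    - by move=> w w' /fg; rewrite pblock_preim /l => /= ->.
    - move=> w w' /gh; rewrite pblock_preim /l.
      by case: w w' => [y|z] [y'|z'] /= ->.
  by rewrite pblock_preim /l; case: u v {uv} => [x|z] [x'|z'] /= /eqP.
pose F := finest_glued (sval a) (sval b).
pose l (t : X + Y + Z) :=
  if [pick w | inXZ Y w \in pblock F t] is Some w then copair f h w else false.
have lF t t' : t' \in pblock F t -> l t = l t'.
  by rewrite -eq_pblockT // /l => /eqP ->.
have lE w : l (inXZ Y w) = copair f h w.
  rewrite /l; case: pickP => [w' ww'|/(_ w)]; last by rewrite mem_pblockT.
  by apply/esym/fh; rewrite pblock_restrict.
have /gluedP[_ aF bF] := finest_glued_glued a b.
exists (fun y => l (inl (inr y))); split=> u v uv.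
- have e w : copair f (fun y => l (inl (inr y))) w = l (inXY Z w).
    by case: w => // x; exact: esym (lE (inl x)).
  by rewrite !e; apply/lF/aF.
- have e w : copair (fun y => l (inl (inr y))) h w = l (inYZ X w).
    by case: w => // z; exact: esym (lE (inr z)).
  by rewrite !e; apply/lF/bF.
Qed.

Lemma compat_bij (X Y : finType) (p : X -> Y) (bp : bijective p) f g :
  compat (corel_bij bp) f g <-> f = g \o p.
Proof.
split=> [fg|->{f} u v].
  apply/funext => x; apply: (fg (inl x) (inr (p x))).
  apply/pblockP; first exact: (svalP (corel_bij bp)).
  by exists [set inl x; inr (p x)]; [apply/imsetP; exists x|rewrite !inE !eqxx].
case/pblockP; first exact: (svalP (corel_bij bp)).
move=> _ /imsetP[x _ ->] []; rewrite !inE.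
by move=> /orP[]/eqP -> /orP[]/eqP ->.
Qed.

Lemma compat_sum (X Y X' Y' : finType) (a : corel X Y) (b : corel X' Y') f g :
  compat (corel_sum a b) f g <->
  compat a (f \o inl) (g \o inl) /\ compat b (f \o inr) (g \o inr).
Proof.
have pS := svalP (corel_sum a b).
have eL w : copair (f \o inl) (g \o inl) w = copair f g (sum_inl X' Y' w).
  by case: w.
have eR w : copair (f \o inr) (g \o inr) w = copair f g (sum_inr X Y w).
  by case: w.
split=> [fg|[fa fb] u v].
  split=> u v.
    case/pblockP => [|B PB [uB vB]]; first exact: (svalP a).
    rewrite !eL; apply: fg; apply/pblockP => //.
    exists (@sum_inl X Y X' Y' @: B); last by rewrite !imset_f.
    by rewrite inE imset_f.
  case/pblockP => [|B PB [uB vB]]; first exact: (svalP b).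
  rewrite !eR; apply: fg; apply/pblockP => //.
  exists (@sum_inr X Y X' Y' @: B); last by rewrite !imset_f.
  by rewrite inE orbC imset_f.
case/pblockP => // B; rewrite inE => /orP[]/imsetP[A PA ->] [].
  move=> /imsetP[u' Au ->] /imsetP[v' Av ->]; rewrite -!eL; apply: fa.
  by apply/pblockP; [exact: (svalP a)|exists A].
move=> /imsetP[u' Au ->] /imsetP[v' Av ->]; rewrite -!eR; apply: fb.
by apply/pblockP; [exact: (svalP b)|exists A].
Qed.

Lemma compat_comp_bij (X Y Z : finType) (a : corel X Y) (p : Y -> Z)
    (bp : bijective p) f h :
  compat (corel_comp a (corel_bij bp)) f h <-> compat a f (h \o p).
Proof.
split=> [/compat_comp[g [fg /compat_bij <-]] //|fh].
by apply/compat_comp; exists (h \o p); split=> //; apply/compat_bij.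
Qed.

Lemma compat_bij_comp (X Y Z : finType) (b : corel Y Z) (p : X -> Y)
    (q : Y -> X) (bp : bijective p) (pK : cancel p q) (qK : cancel q p) f h :
  compat (corel_comp (corel_bij bp) b) f h <-> compat b (f \o q) h.
Proof.
split=> [/compat_comp[g [/compat_bij -> gh]] //|fh].
  suff <- : g = g \o p \o q by [].
  by apply/funext => y /=; rewrite qK.
apply/compat_comp; exists (f \o q); split=> //.
by apply/compat_bij/funext => x /=; rewrite pK.
Qed.

Lemma eq_corel_bij (X Y : finType) (p q : X -> Y) (bp : bijective p)
  (bq : bijective q) : p =1 q -> corel_bij bp = corel_bij bq.
Proof.
by move=> /funext pq; apply: corel_ext => f g; rewrite !compat_bij pq.
Qed.

Lemma corel_bijM (X Y Z : finType) (p : X -> Y) (q : Y -> Z)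
    (bp : bijective p) (bq : bijective q) :
  corel_comp (corel_bij bp) (corel_bij bq) = corel_bij (bij_comp bq bp).
Proof. by apply: corel_ext => f g; rewrite compat_comp_bij !compat_bij. Qed.

Definition sum_map (X Y X' Y' : Type) (p : X -> Y) (q : X' -> Y') :
  X + X' -> Y + Y' := copair (inl \o p) (inr \o q).

Lemma sum_map_bij (X Y X' Y' : Type) (p : X -> Y) (q : X' -> Y') :
  bijective p -> bijective q -> bijective (sum_map p q).
Proof.
move=> [p' pK p'K] [q' qK q'K].
by exists (sum_map p' q') => -[x|x] /=; rewrite ?(pK, p'K, qK, q'K).
Qed.

Lemma corel_bijD (X Y X' Y' : finType) (p : X -> Y) (q : X' -> Y')
    (bp : bijective p) (bq : bijective q) :
  corel_sum (corel_bij bp) (corel_bij bq) = corel_bij (sum_map_bij bp bq).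
Proof.
apply: corel_ext => f g; rewrite compat_sum !compat_bij.
split=> [[fl fr]|->]; last by [].
apply/funext => -[x|x]; first exact: (congr1 (@^~ x) fl).
exact: (congr1 (@^~ x) fr).
Qed.

Section SumBijections.
Variables X Y Z : Type.

Definition sumA (u : X + Y + Z) : X + (Y + Z) :=
  match u with
  | inl (inl x) => inl x | inl (inr y) => inr (inl y) | inr z => inr (inr z)
  end.

Definition sumAV (u : X + (Y + Z)) : X + Y + Z :=
  match u with
  | inl x => inl (inl x) | inr (inl y) => inl (inr y) | inr (inr z) => inr z
  end.

Definition sum0l (u : void + X) : X :=
  match u with inl v => of_void X v | inr x => x end.

Definition sum0r (u : X + void) : X :=
  match u with inl x => x | inr v => of_void X v end.

Definition sumC (u : X + Y) : Y + X :=
  match u with inl x => inr x | inr y => inl y end.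

Lemma sumAK : cancel sumA sumAV. Proof. by case=> [[]|]. Qed.
Lemma sumAVK : cancel sumAV sumA. Proof. by case=> [|[]]. Qed.
Lemma sum0lK : cancel sum0l inr. Proof. by case=> [[]|]. Qed.
Lemma sum0lVK : cancel inr sum0l. Proof. by []. Qed.
Lemma sum0rK : cancel sum0r inl. Proof. by case=> [|[]]. Qed.
Lemma sum0rVK : cancel inl sum0r. Proof. by []. Qed.

End SumBijections.

Lemma sumCK (X Y : Type) : cancel (@sumC X Y) (@sumC Y X).
Proof. by case. Qed.

Definition corel_smc_data : smc_data :=
  @SmcData finType corel corel_id (fun X Y Z b a => corel_comp a b)
    void (fun X Y => (X + Y)%type : finType)
    (fun X Y X' Y' a b => corel_sum a b)
    (fun X Y Z => corel_bij (Bijective (@sumAK X Y Z) (@sumAVK X Y Z)))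
    (fun X Y Z => corel_bij (Bijective (@sumAVK X Y Z) (@sumAK X Y Z)))
    (fun X => corel_bij (Bijective (@sum0lK X) (@sum0lVK X)))
    (fun X => corel_bij (Bijective (@sum0lVK X) (@sum0lK X)))
    (fun X => corel_bij (Bijective (@sum0rK X) (@sum0rVK X)))
    (fun X => corel_bij (Bijective (@sum0rVK X) (@sum0rK X)))
    (fun X Y => corel_bij (Bijective (@sumCK X Y) (@sumCK Y X))).

Lemma corel_smcP : smc_upto (@eq_rel corel_smc_data).
Proof.
split; rewrite /eq_rel /=.
- move=> X Y Z T a b c; apply: corel_ext => f h; split.
  + case/compat_comp=> g [/compat_comp[g' [? ?]] ?].
    apply/compat_comp; exists g'; split=> //.
    by apply/compat_comp; exists g.
  + case/compat_comp=> g [? /compat_comp[g' [? ?]]].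
    apply/compat_comp; exists g'; split=> //.
    by apply/compat_comp; exists g.
- by move=> X Y a; apply: corel_ext => f h; rewrite compat_comp_bij.
- move=> X Y a; apply: corel_ext => f h.
  by rewrite (@compat_bij_comp _ _ _ _ _ id).
- move=> X Y; rewrite corel_bijD; apply: eq_corel_bij; by case.
- move=> X Y Z X' Y' Z' a b a' b'; apply: corel_ext => f h.
  rewrite compat_sum !compat_comp; split.
  + move=> [[g [? ?]] [g' [? ?]]]; exists (copair g g').
    by split; apply/compat_sum; split.
  + by move=> [g [/compat_sum[? ?] /compat_sum[? ?]]]; split;
      [exists (g \o inl)|exists (g \o inr)].
- by move=> X Y Z; rewrite corel_bijM; apply: eq_corel_bij; apply: sumAK.
- by move=> X Y Z; rewrite corel_bijM; apply: eq_corel_bij; apply: sumAVK.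
- by move=> X; rewrite corel_bijM; apply: eq_corel_bij; apply: sum0lK.
- by move=> X; rewrite corel_bijM; apply: eq_corel_bij; apply: sum0lVK.
- by move=> X; rewrite corel_bijM; apply: eq_corel_bij; apply: sum0rK.
- by move=> X; rewrite corel_bijM; apply: eq_corel_bij; apply: sum0rVK.
- move=> X Y Z X' Y' Z' a b c; apply: corel_ext => f h.
  rewrite compat_comp_bij (compat_bij_comp _ _ (@sumAK _ _ _) (@sumAVK _ _ _)).
  by rewrite !compat_sum; split=> [[[]]|[? []]].
- move=> X Y a; apply: corel_ext => f h.
  rewrite compat_comp_bij (compat_bij_comp _ _ (@sum0lK _) (@sum0lVK _)).
  rewrite compat_sum compat_bij; split=> [[]//|?]; split=> //.
  by apply/funext; case.
- move=> X Y a; apply: corel_ext => f h.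
  rewrite compat_comp_bij (compat_bij_comp _ _ (@sum0rK _) (@sum0rVK _)).
  rewrite compat_sum compat_bij; split=> [[]//|?]; split=> //.
  by apply/funext; case.
- move=> X Y X' Y' a b; apply: corel_ext => f h.
  rewrite compat_comp_bij (compat_bij_comp _ _ (@sumCK _ _) (@sumCK _ _)).
  by rewrite !compat_sum; split=> -[].
- by move=> X Y; rewrite corel_bijM; apply: eq_corel_bij; apply: sumCK.
- move=> X Y; rewrite !(corel_bijM, corel_bijD); apply: eq_corel_bij.
  by case=> [[x|[]]|y].
- move=> X Y Z T; rewrite !(corel_bijM, corel_bijD); apply: eq_corel_bij.
  by case=> [[[]|]|].
- by move=> X; rewrite corel_bijM; apply: eq_corel_bij => -[|].
- move=> X Y Z; rewrite !(corel_bijM, corel_bijD); apply: eq_corel_bij.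
  by case=> [[]|].
Qed.

Definition Corel : smcat := Smcat corel_smcP.

(* Main.v *)
(* Every morphism of Th(ESCFM) acts on "cospan legs": for u : {0..n-1} -> {0..k-1}
   let [star k n u] : k -> n be the comonoid map sending the output wire i to
   the input wire u i. For t : n -> m one has t ∘ star u = star v ∘ Z, where Z
   only creates new wires or joins two of them (Frobenius and special laws); as
   joining two of k disconnected wires amounts to relabelling them, every
   t : 0 -> m is star u ∘ η^k for some u. By the extra law such a state only
   depends on which values of u are equal, that is, on a partition of
   {0..m-1}, and every partition occurs. Since the Frobenius structure bends
   inputs into outputs, Th(ESCFM) -> Corel, n |-> {0..n-1}, is then full and
   faithful on all hom-sets, and it is essentially surjective.

   A corelation is determined by the two-valued labelings that are constant on
   its classes, and composition of corelations is composition of the resulting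
   relations between labelings. *)

From mathcomp Require Import all_boot.
From mathcomp Require Import boolp zify.
Require Import Defs.

Set Implicit Arguments.
Unset Strict Implicit.
Unset Printing Implicit Defensive.

Declare Scope pr_scope.
Delimit Scope pr_scope with pr.
Local Open Scope pr_scope.
Local Notation "g ∘ f" := (pcomp g f) : pr_scope.
Local Notation "f ⊕ g" := (psum f g) (at level 35, right associativity) : pr_scope.

(** * Wire calculus *)

Section PropExtra.
Variable P : prop.

Lemma psumA a b c a' b' c' (f : phom P a a') (g : phom P b b')
    (h : phom P c c') :
  eqhom P (esym (addnA a' b' c')) ∘ ((f ⊕ g) ⊕ h) =
  (f ⊕ (g ⊕ h)) ∘ eqhom P (esym (addnA a b c)).
Proof. exact: (ax_assocN (propP P) f g h). Qed.

Lemma psum0m n m (f : phom P n m) : pid P 0 ⊕ f = f.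
Proof.
have := ax_lunitN (propP P) f; rewrite /eq_rel /= => e.
rewrite -[LHS](@pcomp1m P) -(@eqhom_id P m (add0n m)) e.
by rewrite (@eqhom_id P n) pcompm1.
Qed.

Lemma pbraidN a b a' b' (f : phom P a a') (g : phom P b b') :
  pbraid P a' b' ∘ (f ⊕ g) = (g ⊕ f) ∘ pbraid P a b.
Proof. exact: (ax_braidN (propP P) f g). Qed.

Lemma psum_idA a n m (f : phom P n m) :
  pid P a.+1 ⊕ f = pid P 1 ⊕ (pid P a ⊕ f).
Proof.
have := psumA (pid P 1) (pid P a) f.
by rewrite !eqhom_id pcomp1m pcompm1 psum1.
Qed.

Lemma psum_slide a b n m (g : phom P a b) (f : phom P n m) :
  (g ⊕ pid P m) ∘ (pid P a ⊕ f) = (pid P b ⊕ f) ∘ (g ⊕ pid P n).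
Proof. by rewrite -!psumM !pcomp1m !pcompm1. Qed.

Lemma psum_pidM a b c n (f : phom P a b) (g : phom P b c) (h : phom P a c) :
  g ∘ f = h -> (g ⊕ pid P n) ∘ (f ⊕ pid P n) = h ⊕ pid P n.
Proof. by move=> <-; rewrite -psumM pcomp1m. Qed.

Lemma psum_pidM1 a b n (f : phom P a b) (g : phom P b a) :
  g ∘ f = pid P a -> (g ⊕ pid P n) ∘ (f ⊕ pid P n) = pid P (a + n).
Proof. by move=> /psum_pidM ->; apply: psum1. Qed.

Lemma psum_pidMM a b b' c n (f : phom P a b) (g : phom P b c)
    (f' : phom P a b') (g' : phom P b' c) : g ∘ f = g' ∘ f' ->
  (g ⊕ pid P n) ∘ (f ⊕ pid P n) = (g' ⊕ pid P n) ∘ (f' ⊕ pid P n).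
Proof. by move=> /psum_pidM ->; rewrite (psum_pidM _ erefl). Qed.

Lemma pcomp_pre n m k (f : phom P n m) (g : phom P m k) (h : phom P n k) :
  g ∘ f = h -> forall j (x : phom P j n), g ∘ (f ∘ x) = h ∘ x.
Proof. by move=> <- j x; rewrite pcompA. Qed.

Lemma pcomp_pre3 n m k l (f : phom P n m) (g : phom P m k) (h : phom P k l)
    (e : phom P n l) :
  h ∘ (g ∘ f) = e -> forall j (x : phom P j n), h ∘ (g ∘ (f ∘ x)) = e ∘ x.
Proof. by move=> <- j x; rewrite !pcompA. Qed.

End PropExtra.

(** The calculus below is run twice, in [Th_ESCFM] itself and in the prop of corelations between
    ordinals, so it is developed in any prop carrying the structure. *)
Record model (P : prop) := Model {
  gen : forall n m, escfm_gen n m -> phom P n m;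
  genP : forall n m (t t' : term escfm_sig n m),
    escfm_eqn t t' -> teval gen t = teval gen t'
}.

(* With numerals on the left both associators are identities, by conversion. *)
Local Ltac strict_assoc f g h :=
  have := psumA f g h; rewrite !eqhom_id pcomp1m pcompm1 ?psum1 => ->.

(** * Generators on the front wires *)

Section Wires.
Variables (P : prop) (M : model P).

(** Every generator is placed on the front wires, and other positions are reached through [up] and
    [sw]. The arities are then successors, for which the strict associators are identities by
    conversion. *)
Definition up n m (f : phom P n m) : phom P n.+1 m.+1 := pid P 1 ⊕ f.
Definition sw n : phom P n.+2 n.+2 := pbraid P 1 1 ⊕ pid P n.
Definition mu n : phom P n.+2 n.+1 := gen M gen_mu ⊕ pid P n.
Definition et n : phom P n n.+1 := gen M gen_eta ⊕ pid P n.
Definition de n : phom P n.+1 n.+2 := gen M gen_delta ⊕ pid P n.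
Definition ep n : phom P n.+1 n := gen M gen_eps ⊕ pid P n.

Lemma up1 n : up (pid P n) = pid P n.+1.
Proof. exact: (@psum1 P 1 n). Qed.

Lemma upM n m k (f : phom P n m) (g : phom P m k) : up (g ∘ f) = up g ∘ up f.
Proof.
rewrite /up -{1}(pcomp1m (pid P 1)).
exact: (psumM (pid P 1) (pid P 1) f g).
Qed.

Lemma up_up n m (f : phom P n m) : up (up f) = pid P 2 ⊕ f.
Proof. by rewrite psum_idA. Qed.

Lemma swN n m (f : phom P n m) : sw m ∘ up (up f) = up (up f) ∘ sw n.
Proof. by rewrite up_up; exact: (psum_slide (pbraid P 1 1) f). Qed.

Lemma muN n m (f : phom P n m) : mu m ∘ up (up f) = up f ∘ mu n.
Proof. by rewrite up_up; exact: (psum_slide (gen M gen_mu) f). Qed.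

Lemma deN n m (f : phom P n m) : de m ∘ up f = up (up f) ∘ de n.
Proof. by rewrite up_up; exact: (psum_slide (gen M gen_delta) f). Qed.

Lemma epN n m (f : phom P n m) : ep m ∘ up f = f ∘ ep n.
Proof. by rewrite -{2}(psum0m f); exact: (psum_slide (gen M gen_eps) f). Qed.

Lemma etN n m (f : phom P n m) : et m ∘ f = up f ∘ et n.
Proof. by rewrite -{1}(psum0m f); exact: (psum_slide (gen M gen_eta) f). Qed.

(** Here and in the next lemmas an operation is regrouped as one on the first few wires beside n
    idle ones, so that an equation of the theory can be tensored with an identity. *)
Lemma muS n : mu n.+1 = (gen M gen_mu ⊕ pid P 1) ⊕ pid P n.
Proof. by strict_assoc (gen M gen_mu) (pid P 1) (pid P n). Qed.

Lemma deS n : de n.+1 = (gen M gen_delta ⊕ pid P 1) ⊕ pid P n.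
Proof. by strict_assoc (gen M gen_delta) (pid P 1) (pid P n). Qed.

Lemma epS n : ep n.+1 = (gen M gen_eps ⊕ pid P 1) ⊕ pid P n.
Proof. by strict_assoc (gen M gen_eps) (pid P 1) (pid P n). Qed.

Lemma etS n : et n.+1 = (gen M gen_eta ⊕ pid P 1) ⊕ pid P n.
Proof. by strict_assoc (gen M gen_eta) (pid P 1) (pid P n). Qed.

Lemma swS n : sw n.+1 = (pbraid P 1 1 ⊕ pid P 1) ⊕ pid P n.
Proof. by strict_assoc (pbraid P 1 1) (pid P 1) (pid P n). Qed.

Lemma up_mu n : up (mu n) = (pid P 1 ⊕ gen M gen_mu) ⊕ pid P n.
Proof. by strict_assoc (pid P 1) (gen M gen_mu) (pid P n). Qed.

Lemma up_de n : up (de n) = (pid P 1 ⊕ gen M gen_delta) ⊕ pid P n.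
Proof. by strict_assoc (pid P 1) (gen M gen_delta) (pid P n). Qed.

Lemma up_ep n : up (ep n) = (pid P 1 ⊕ gen M gen_eps) ⊕ pid P n.
Proof. by strict_assoc (pid P 1) (gen M gen_eps) (pid P n). Qed.

Lemma up_et n : up (et n) = (pid P 1 ⊕ gen M gen_eta) ⊕ pid P n.
Proof. by strict_assoc (pid P 1) (gen M gen_eta) (pid P n). Qed.

Lemma up_sw n : up (sw n) = (pid P 1 ⊕ pbraid P 1 1) ⊕ pid P n.
Proof. by strict_assoc (pid P 1) (pbraid P 1 1) (pid P n). Qed.

Lemma mu_unit n : mu n ∘ et n.+1 = pid P n.+1.
Proof. by rewrite etS; exact: psum_pidM1 (genP M eqn_mul_unit). Qed.

Lemma mu_comm n : mu n ∘ sw n = mu n.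
Proof. exact: psum_pidM (genP M eqn_mul_comm). Qed.

Lemma de_assoc n : de n.+1 ∘ de n = up (de n) ∘ de n.
Proof. by rewrite deS up_de; exact: psum_pidMM (genP M eqn_comul_assoc). Qed.

Lemma de_unit n : ep n.+1 ∘ de n = pid P n.+1.
Proof. by rewrite epS; exact: psum_pidM1 (genP M eqn_comul_unit). Qed.

Lemma de_comm n : sw n ∘ de n = de n.
Proof. exact: psum_pidM (genP M eqn_comul_comm). Qed.

Lemma frobl n : up (mu n) ∘ de n.+1 = de n ∘ mu n.
Proof. by rewrite up_mu deS; exact: psum_pidMM (genP M eqn_frobl). Qed.

Lemma special n : mu n ∘ de n = pid P n.+1.
Proof. exact: psum_pidM1 (genP M eqn_special). Qed.

Lemma extra n : ep n ∘ et n = pid P n.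
Proof. exact: psum_pidM1 (genP M eqn_extra). Qed.

Lemma swK n : sw n ∘ sw n = pid P n.+2.
Proof. exact: psum_pidM1 (pbraidK P 1 1). Qed.

Lemma sw_et n : sw n ∘ et n.+1 = up (et n).
Proof.
have := pbraidN (gen M gen_eta) (pid P 1).
rewrite pbraid0n eqhom_id pcompm1 etS up_et => e.
exact: psum_pidM e.
Qed.

(** An instance of the hexagon. It turns naturality of the braiding at the multiplication, the
    comultiplication and the braiding itself into the three slide laws that follow, the last being
    the Yang-Baxter equation. *)
Lemma pbraid21 :
  pbraid P 2 1 = (pbraid P 1 1 ⊕ pid P 1) ∘ (pid P 1 ⊕ pbraid P 1 1).
Proof. by rewrite (@pbraidDn P 1 1 1) !eqhom_id pcompm1 !pcomp1m. Qed.

Lemma sw_mu n : up (mu n) ∘ (sw n.+1 ∘ up (sw n)) = sw n ∘ mu n.+1.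
Proof.
have := pbraidN (gen M gen_mu) (pid P 1) => e.
rewrite muS up_mu swS up_sw.
rewrite (psum_pidM n (esym pbraid21)).
exact: psum_pidMM (esym e).
Qed.

Lemma sw_de n : sw n.+1 ∘ (up (sw n) ∘ de n.+1) = up (de n) ∘ sw n.
Proof.
have := pbraidN (gen M gen_delta) (pid P 1) => e.
rewrite deS up_de swS up_sw pcompA.
rewrite (psum_pidM n (esym pbraid21)).
exact: psum_pidMM e.
Qed.

Lemma sw_YB n :
  sw n.+1 ∘ (up (sw n) ∘ sw n.+1) = up (sw n) ∘ (sw n.+1 ∘ up (sw n)).
Proof.
have := pbraidN (pbraid P 1 1) (pid P 1) => e.
rewrite swS up_sw pcompA.
rewrite (psum_pidM n (esym pbraid21)).
exact: psum_pidMM e.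
Qed.

Lemma sw_ep n : ep n.+1 ∘ sw n = up (ep n).
Proof.
have := pbraidN (pid P 1) (gen M gen_eps).
rewrite pbraidn0 eqhom_id pcomp1m epS up_ep => e.
exact: psum_pidM (esym e).
Qed.

Lemma up_swK n : up (sw n) ∘ up (sw n) = pid P n.+3.
Proof. by rewrite -upM swK up1. Qed.

Lemma up_ep_sw n : up (ep n) ∘ sw n = ep n.+1.
Proof. by rewrite -sw_ep -pcompA swK pcompm1. Qed.

Lemma sw_up_et n : sw n ∘ up (et n) = et n.+1.
Proof. by rewrite -sw_et pcompA swK pcomp1m. Qed.

Lemma sw_deV n : up (sw n) ∘ (sw n.+1 ∘ up (de n)) = de n.+1 ∘ sw n.
Proof.
rewrite -[up (de n)]pcompm1 -(swK n) (pcompA _ _ (up (de n))) -sw_de -!pcompA.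
by rewrite (pcomp_pre (swK _)) pcomp1m (pcomp_pre (up_swK _)) pcomp1m.
Qed.

Lemma up_de_unit n : up (ep n) ∘ de n = pid P n.+1.
Proof. by rewrite -de_comm pcompA up_ep_sw de_unit. Qed.

(** * Copying and relabelling wires *)

(* The wire i of k wires is duplicated and the copy is put in front; when
   k <= i, the new front wire is disconnected from the others. *)
Fixpoint copy k i : phom P k k.+1 :=
  match k return phom P k k.+1 with
  | 0 => et 0
  | k'.+1 => if i is i'.+1 then sw k' ∘ up (copy k' i') else de k'
  end.

(** Cocommutativity settles two copies of wire 0, the slide law of [de] a single one, and the
    Yang-Baxter equation lets the induction hypothesis through when neither source is wire 0. *)
Lemma copyC k x y :
  sw k ∘ (up (copy k y) ∘ copy k x) = up (copy k x) ∘ copy k y.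
Proof.
elim: k x y => [|k IHk] x y /=; first by rewrite -etN pcompA sw_et -etN.
case: x y => [|x] [|y] /=.
- by rewrite -de_assoc pcompA de_comm.
- by rewrite upM -!pcompA -deN (pcomp_pre3 (sw_de k)) -pcompA.
- rewrite (pcomp_pre (esym (sw_de k))) -!pcompA (pcomp_pre (swK _)) pcomp1m.
  by rewrite deN pcompA upM.
- rewrite !upM -!pcompA (pcomp_pre (esym (swN _))) -!pcompA.
  rewrite (pcomp_pre3 (sw_YB k)) -!pcompA -!upM IHk upM.
  by rewrite (pcomp_pre (swN _)) -!pcompA.
Qed.

(** Coassociativity transported to wire x. For k <= x the left side would duplicate one fresh wire,
    the right side create two unrelated ones. *)
Lemma copy_de k x : x < k -> de k ∘ copy k x = up (copy k x) ∘ copy k x.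
Proof.
elim: k x => [|k IHk] [|x] //= lt_xk; first exact: de_assoc.
rewrite (pcomp_pre (esym (sw_deV k))) upM -!pcompA -upM IHk // upM.
by rewrite (pcomp_pre (swN _)) -!pcompA.
Qed.

Lemma copy_ep k x : ep k ∘ copy k x = pid P k.
Proof.
(* For k = 0 the copy is a fresh wire, which the extra law discards. *)
elim: k x => [|k IHk] [|x] //=; rewrite ?extra ?de_unit //.
by rewrite (pcomp_pre (sw_ep k)) -upM IHk up1.
Qed.

Lemma copy_et k x : k <= x -> copy k x = et k.
Proof.
elim: k x => [|k IHk] [|x] //= le_kx; first by rewrite IHk // sw_up_et.
Qed.

Lemma copyS_et k x : copy k.+1 x.+1 ∘ et k = up (et k) ∘ copy k x.
Proof. by rewrite /= -pcompA -etN pcompA sw_et. Qed.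

(* Only the values u 0, ..., u (n - 1) matter. *)
Fixpoint star k n (u : nat -> nat) : phom P k n :=
  match n return phom P k n with
  | 0 => (fix discard k : phom P k 0 :=
      if k is k'.+1 then discard k' ∘ ep k' else pid P 0) k
  | n'.+1 => up (star k n' (u \o S)) ∘ copy k (u 0)
  end.

Fixpoint etas k : phom P 0 k :=
  if k is k'.+1 then et k' ∘ etas k' else pid P 0.

Lemma copySS k i : copy k.+1 i.+1 = sw k ∘ up (copy k i).
Proof. by []. Qed.

Lemma etasS k : etas k.+1 = et k ∘ etas k.
Proof. by []. Qed.

Lemma starSn k n u : star k n.+1 u = up (star k n (u \o S)) ∘ copy k (u 0).
Proof. by []. Qed.

Lemma star0S k u : star k.+1 0 u = star k 0 u ∘ ep k.
Proof. by []. Qed.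

Lemma eq_star k n u v : (forall i, i < n -> u i = v i) -> star k n u = star k n v.
Proof.
elim: n u v => // n IHn u v uv /=.
by rewrite uv // (IHn _ (v \o S)) // => i lt_in; apply: uv.
Qed.

(** Outputs are copies of their nodes, so copying an output once more copies its node once more:
    coassociativity for output 0, [copyC] to get past the others. *)
Lemma copy_star k n u i : i < n -> u i < k ->
  copy n i ∘ star k n u = up (star k n u) ∘ copy k (u i).
Proof.
elim: n u i => [|n IHn] u [|i] //= lt_in lt_uk.
  by rewrite pcompA deN -!pcompA copy_de // upM pcompA.
rewrite -!pcompA (pcomp_pre (esym (upM _ _))) IHn // !upM -!pcompA.
by rewrite (pcomp_pre (swN _)) -!pcompA copyC.
Qed.

Lemma star0M j k v w : star k 0 w ∘ star j k v = star j 0 w.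
Proof.
elim: k v => [|k IHk] v; first exact: pcomp1m.
rewrite star0S [star j k.+1 v]/= -!pcompA (pcomp_pre (epN _)) -!pcompA copy_ep.
by rewrite pcompm1.
Qed.

(** Each copy made by the outer [star] is pushed through the inner one by [copy_star], whence the
    bounds. Thus [star] is a contravariant functor of its labels. *)
Lemma starM j k n u v : (forall i, i < n -> u i < k /\ v (u i) < j) ->
  star k n u ∘ star j k v = star j n (v \o u).
Proof.
elim: n u => [|n IHn] u uk; first exact: star0M.
have [u0k vuj] := uk 0 isT; rewrite /= -pcompA copy_star // pcompA -upM.
by rewrite IHn // => i lt_in; apply: uk.
Qed.

Lemma starS k n u : star k.+1 n (S \o u) = star k n u ∘ ep k.
Proof.
elim: n u => // n IHn u /=.
rewrite (IHn (u \o S)) upM -pcompA (pcomp_pre (up_ep_sw k)) epN.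
by rewrite pcompA.
Qed.

Lemma star_id k : star k k id = pid P k.
Proof.
elim: k => //= k IHk.
by rewrite (starS k k id) upM IHk up1 pcomp1m up_de_unit.
Qed.

Definition consf (T : Type) (x : T) (u : nat -> T) i :=
  if i is i'.+1 then u i' else x.

Lemma star_up k n u : star k.+1 n.+1 (consf 0 (S \o u)) = up (star k n u).
Proof.
rewrite [LHS]/= (starS k n u).
by rewrite upM -pcompA up_de_unit pcompm1.
Qed.

(** * Pairing and joining wires *)

(* Locked, as [upM] would otherwise rewrite under it. *)
Definition cap n : phom P n.+2 n := locked (ep n ∘ mu n).

Lemma capE n : cap n = ep n ∘ mu n.
Proof. by rewrite /cap -lock. Qed.

Lemma capN n m (f : phom P n m) : cap m ∘ up (up f) = f ∘ cap n.
Proof. by rewrite !capE -pcompA muN (pcomp_pre (epN _)) pcompA. Qed.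

Lemma cap_comm n : cap n ∘ sw n = cap n.
Proof. by rewrite !capE -pcompA mu_comm. Qed.

Lemma up_cap_sw n : up (cap n) ∘ (sw n.+1 ∘ up (sw n)) = cap n.+1.
Proof. by rewrite !capE upM -pcompA sw_mu pcompA up_ep_sw. Qed.

Lemma cap_up_sw n : cap n.+1 ∘ (up (sw n) ∘ sw n.+1) = up (cap n).
Proof.
rewrite -up_cap_sw -!pcompA (pcomp_pre (up_swK _)) pcomp1m swK.
exact: pcompm1.
Qed.

(** The Frobenius law recovers the multiplication from [cap] and [de]; this is how multiplications
    become joins below. *)
Lemma up_cap_de n : up (cap n) ∘ de n.+1 = mu n.
Proof. by rewrite capE upM -pcompA frobl pcompA up_de_unit pcomp1m. Qed.

(* Merges the classes of the wires x and y of k wires. *)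
Definition join k x y : phom P k k := cap k ∘ (up (copy k y) ∘ copy k x).

Lemma joinC k x y : join k x y = join k y x.
Proof. by rewrite /join -{1}cap_comm -pcompA copyC. Qed.

(** A [join] duplicates two wires and pairs off the duplicates, and both steps commute with a
    further copy. *)
Lemma copy_join k x y i : up (join k x y) ∘ copy k i = copy k i ∘ join k x y.
Proof.
rewrite /join !upM -!pcompA -(copyC k x i) (pcomp_pre (esym (swN _))) -!pcompA.
rewrite (pcomp_pre (esym (upM _ _))) -(copyC k y i) !upM -!pcompA.
by rewrite (pcomp_pre3 (up_cap_sw k)) (pcomp_pre (capN _)) -pcompA.
Qed.

(** By [up_cap_de] the product duplicates the copy of x and pairs one half with the copy of y; that
    pairing is the [join]. *)
Lemma mu_copy k x y : x < k ->
  mu k ∘ (up (copy k y) ∘ copy k x) = copy k x ∘ join k x y.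
Proof.
move=> lt_xk; rewrite -copy_join /join !upM -!pcompA -copy_de //.
by rewrite (pcomp_pre (esym (deN _))) -!pcompA (pcomp_pre (up_cap_de _)).
Qed.

Lemma join_star k n u x y : x < n -> y < n -> (forall i, i < n -> u i < k) ->
  join n x y ∘ star k n u = star k n u ∘ join k (u x) (u y).
Proof.
move=> lt_xn lt_yn uk; rewrite /join -!pcompA copy_star ?uk //.
rewrite (pcomp_pre (esym (upM _ _))) copy_star ?uk // upM -pcompA.
by rewrite (pcomp_pre (capN _)) -pcompA.
Qed.

Lemma up_join k x y : join k.+1 x.+1 y.+1 = up (join k x y).
Proof.
rewrite /join /= !upM -!pcompA (pcomp_pre (esym (swN _))) -!pcompA.
by rewrite (pcomp_pre3 (cap_up_sw k)).
Qed.

Lemma join0 k : join k.+1 0 0 = pid P k.+1.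
Proof.
rewrite /join capE /= -de_assoc -pcompA (pcomp_pre (special _)) pcomp1m.
exact: de_unit.
Qed.

Lemma cap_snake k :
  cap k.+1 ∘ (up (sw k) ∘ (de k.+1 ∘ et k.+1)) = pid P k.+1.
Proof.
have e : cap k.+1 ∘ up (sw k) = up (cap k) ∘ sw k.+1.
  by rewrite -cap_up_sw -!pcompA swK pcompm1.
by rewrite pcompA e -pcompA (pcomp_pre (de_comm _)) pcompA up_cap_de mu_unit.
Qed.

(** By the snake equation the fresh wire straightens into a second strand of wire y. This is why
    joining disconnected wires only relabels them. *)
Lemma join0S k y : join k.+1 0 y.+1 ∘ et k = copy k y.
Proof.
rewrite /join /= upM -!pcompA (pcomp_pre (esym (deN _))) -!pcompA -etN.
by have := pcomp_pre (cap_snake k) (copy k y); rewrite -!pcompA pcomp1m.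
Qed.

(** * States and joins of disconnected wires *)

Definition is_state n (w : phom P 0 n) :=
  exists k u, (forall i, i < n -> u i < k) /\ w = star k n u ∘ etas k.

Lemma star_state k n u w : (forall i, i < n -> u i < k) -> is_state w ->
  is_state (star k n u ∘ w).
Proof.
move=> uk [j [v [vj ->]]]; exists j, (v \o u); split=> [i /uk /vj //|].
by rewrite pcompA starM // => i /uk; split=> //; apply: vj.
Qed.

Lemma etas_state k : is_state (etas k).
Proof. by exists k, id; split=> //; rewrite star_id pcomp1m. Qed.

Lemma et_state n w : is_state w -> is_state (et n ∘ w).
Proof.
move=> [k [u [uk ->]]]; exists k.+1, (consf 0 (S \o u)).
split=> [[|i] //= /uk //|].
by rewrite star_up etasS !pcompA etN.
Qed.

Lemma up_et_state n w k (f : phom P k n) : f ∘ etas k = w -> is_state w ->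
  is_state (up f ∘ etas k.+1).
Proof. by move=> <- /et_state; rewrite etasS pcompA etN -pcompA. Qed.

(** [up_join] lowers both positions until one is 0. That wire is then joined with itself, which does
    nothing, or with another wire, of which it becomes a copy by [join0S]. *)
Lemma join_etas_state k x y : x < k -> y < k -> is_state (join k x y ∘ etas k).
Proof.
elim: k x y => // k IHk.
have join0y y : y < k.+1 -> is_state (join k.+1 0 y ∘ etas k.+1).
  case: y => [_|y lt_yk]; first by rewrite join0 pcomp1m; apply: etas_state.
  rewrite etasS pcompA join0S.
  exists k, (consf y id); split; first by case.
  by rewrite /= (star_id k) up1 pcomp1m.
move=> [|x] [|y] lt_xk lt_yk; try exact: join0y.
  by rewrite joinC; exact: join0y.
by rewrite up_join; apply: up_et_state (IHk _ _ lt_xk lt_yk).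
Qed.

Lemma join_state n x y w : x < n -> y < n -> is_state w ->
  is_state (join n x y ∘ w).
Proof.
move=> lt_xn lt_yn [k [u [uk ->]]]; rewrite pcompA join_star // -pcompA.
by apply: star_state => //; apply: join_etas_state; apply: uk.
Qed.

Lemma star_bumpS k x :
  star k.+2 k.+1 (bump x.+1) = up (star k.+1 k (bump x)).
Proof. by rewrite -star_up; apply: eq_star => -[|i] //= _; rewrite bumpS. Qed.

Lemma star_bump0 k : star k.+1 k (bump 0) = ep k.
Proof.
by rewrite -[RHS]pcomp1m -star_id -starS; apply: eq_star.
Qed.

(** As [bump x] skips the value x, the [star] discards exactly wire x, which is disconnected and
    vanishes by the extra law. *)
Lemma star_bump_etas k x : x <= k ->
  star k.+1 k (bump x) ∘ etas k.+1 = etas k.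
Proof.
elim: x k => [|x IHx] k; first by rewrite star_bump0 /= pcompA extra pcomp1m.
case: k => // k lt_xk; rewrite star_bumpS etasS pcompA -etN -pcompA.
by rewrite IHx.
Qed.

(** Wire x is copied to the front and its original discarded, so by the counit law the front copy
    takes its place as a disconnected wire. *)
Lemma up_star_bump_copy k x : x <= k ->
  up (star k.+1 k (bump x)) ∘ (copy k.+1 x ∘ etas k.+1) = et k ∘ etas k.
Proof.
elim: x k => [|x IHx] k.
  by rewrite star_bump0 (pcomp_pre (up_de_unit _)) pcomp1m.
case: k => // k lt_xk; rewrite star_bumpS etasS.
rewrite (pcomp_pre (copyS_et _ _)) -!pcompA (pcomp_pre (esym (upM _ _))).
have := IHx k lt_xk; rewrite etasS => {}IHx.
by rewrite -etN upM -pcompA IHx pcompA -etN -pcompA.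
Qed.

Lemma star_avoid k n u x : x <= k ->
  (forall i, i < n -> u i < k.+1) -> (forall i, i < n -> u i != x) ->
  star k.+1 n u = star k n (unbump x \o u) ∘ star k.+1 k (bump x).
Proof.
move=> le_xk uk ux; rewrite starM => [|i lt_in /=]; last first.
  have := ux _ lt_in; have := uk _ lt_in; rewrite /bump /unbump.
  by lia.
by apply: eq_star => i lt_in /=; rewrite unbumpK // inE ux.
Qed.

Lemma star0_etas k u : star k 0 u ∘ etas k = pid P 0.
Proof.
elim: k => [|k IHk]; first exact: pcomp1m.
by rewrite star0S etasS -pcompA (pcomp_pre (extra _)) pcomp1m.
Qed.

(* The state in which the wires i and j are connected iff u i = u j: as the
   wire 0 is a copy of the first wire with the same label, if any, only these
   equalities matter. *)
Fixpoint pat n (u : nat -> nat) : phom P 0 n :=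
  if n is n'.+1 then copy n' (index (u 0) (mkseq (u \o S) n')) ∘ pat n' (u \o S)
  else pid P 0.

(** If the label of output 0 recurs, output 0 is a copy of its first recurrence; otherwise its node
    feeds nothing else and output 0 is a fresh wire. *)
Lemma star_pat k n u : (forall i, i < n -> u i < k) ->
  star k n u ∘ etas k = pat n u.
Proof.
elim: n k u => [|n IHn] k u uk; first exact: star0_etas.
have u'k i : i < n -> (u \o S) i < k by move=> lt_in; apply: uk.
rewrite /= -pcompA; set s := mkseq _ _; set j := index _ _.
(* When the label does not recur, [index] returns n, and copying wire n of n wires creates a fresh
   one by [copy_et]. *)
have [lt_jn|le_nj] := ltnP j n.
  have uj : u 0 = (u \o S) j.
    have : u 0 \in s by rewrite -index_mem size_mkseq.
    by move/(nth_index 0); rewrite nth_mkseq.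
  by rewrite uj pcompA -copy_star ?u'k // -pcompA IHn.
rewrite (copy_et le_nj) -(IHn k) //.
have u'0 i : i < n -> (u \o S) i != u 0.
  move=> lt_in; apply: contraTneq le_nj => ui; rewrite -ltnNge.
  rewrite -(size_mkseq (u \o S) n) index_mem -ui.
  by apply/mapP; exists i; rewrite // mem_iota.
have := uk 0 isT; case: k uk u'k => // k uk u'k; rewrite ltnS => le_u0k.
(* No later output uses the node [u 0]: it is discarded once its copy is in front, which leaves k
   nodes for the others. *)
rewrite (star_avoid le_u0k) // upM -!pcompA up_star_bump_copy //.
by rewrite star_bump_etas // (pcomp_pre (etN _)) -pcompA.
Qed.

Lemma eq_pat n u v :
  (forall i j, i < n -> j < n -> (u i == u j) = (v i == v j)) ->
  pat n u = pat n v.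
Proof.
elim: n u v => //= n IHn u v uv; rewrite (IHn _ (v \o S)); last first.
  by move=> i j lt_in lt_jn; apply: uv.
congr (copy _ _ ∘ _); rewrite /index !find_map.
apply: eq_in_find => i; rewrite mem_iota /= => lt_in.
exact: uv.
Qed.

(** * Bending inputs into outputs *)

Definition bend n m (t : phom P n.+1 m) : phom P n m.+1 :=
  up t ∘ (de n ∘ et n).

Definition unbend n m (t : phom P n m.+1) : phom P n.+1 m :=
  cap m ∘ up t.

Lemma mu_up_de n : mu n.+1 ∘ up (de n) = de n ∘ mu n.
Proof.
by rewrite muS up_de; apply/esym; exact: psum_pidMM (genP M eqn_frobr).
Qed.

(** A snake equation, from the right Frobenius equation and the unit and counit laws. It reduces
    fullness and faithfulness to morphisms out of 0. *)
Lemma bendK n m (t : phom P n.+1 m) : unbend (bend t) = t.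
Proof.
rewrite /unbend /bend !upM (pcomp_pre (capN _)) -pcompA capE -pcompA.
rewrite (pcomp_pre (mu_up_de _)) -pcompA (pcomp_pre (de_unit _)) pcomp1m.
by rewrite -sw_et (pcomp_pre (mu_comm _)) mu_unit pcompm1.
Qed.

(** * Pushing terms through relabellings *)

(* The operations on the nodes k that appear when a term is pushed through a
   [star]: phi renames the old nodes. *)
Definition node_op k k' (phi : nat -> nat) (Z : phom P k k') :=
  (forall x, x < k ->
     phi x < k' /\ up Z ∘ copy k x = copy k' (phi x) ∘ Z) /\
  (forall w, is_state w -> is_state (Z ∘ w)).

Lemma node_op1 k : node_op id (pid P k).
Proof.
split=> [x lt_xk|w]; last by rewrite pcomp1m.
by rewrite up1 pcomp1m pcompm1.
Qed.

Lemma node_opM k k' k'' phi psi (Z : phom P k k') (Z' : phom P k' k'') :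
  node_op phi Z -> node_op psi Z' -> node_op (psi \o phi) (Z' ∘ Z).
Proof.
move=> [cZ sZ] [cZ' sZ']; split=> [x /cZ[/cZ'[? e'] e]|w /sZ/sZ'].
  by split=> //; rewrite upM -pcompA e pcompA e' -pcompA.
by rewrite pcompA.
Qed.

Lemma node_op_et k : node_op S (et k).
Proof.
split=> [x lt_xk|w]; last exact: et_state.
by rewrite copyS_et.
Qed.

Lemma node_op_join k x y : x < k -> y < k -> node_op id (join k x y).
Proof.
move=> lt_xk lt_yk; split=> [i lt_ik|w]; last exact: join_state.
by rewrite copy_join.
Qed.

Definition acts k n m (X : phom P n m) (u : nat -> nat) :=
  exists k' phi (Z : phom P k k') v,
    [/\ node_op phi Z, forall i, i < m -> v i < k'
      & X ∘ star k n u = star k' m v ∘ Z].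

Lemma acts_eq k n m (X : phom P n m) u v : (forall i, i < m -> v i < k) ->
  X ∘ star k n u = star k m v -> acts k X u.
Proof.
move=> vk e; exists k, id, (pid P k), v; split=> //; first exact: node_op1.
by rewrite pcompm1.
Qed.

Lemma actsM k n m p (X : phom P n m) (Y : phom P m p) u :
  acts k X u ->
  (forall k' v, (forall i, i < m -> v i < k') -> acts k' Y v) ->
  acts k (Y ∘ X) u.
Proof.
move=> [k' [phi [Z [v [opZ vk' e]]]]] /(_ _ _ vk').
move=> [k'' [psi [Z' [v' [opZ' v'k'' e']]]]].
exists k'', (psi \o phi), (Z' ∘ Z), v'; split=> //; first exact: node_opM.
by rewrite -pcompA e pcompA e' pcompA.
Qed.

(** An idle front wire is a copy of its node. As Z commutes with copying up to the renaming [phi],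
    it becomes a copy of the renamed node. *)
Lemma acts_psum a k n m (X : phom P n m) u : (forall i, i < a -> u i < k) ->
  acts k X (fun i => u (a + i)) -> acts k (pid P a ⊕ X) u.
Proof.
elim: a u => [|a IHa] u uk; first by rewrite psum0m.
move=> aX; rewrite psum_idA -/(up _).
have [|k' [phi [Z [v [opZ vk' e]]]]] := IHa (u \o S) _ aX.
  by move=> i lt_ia; apply: uk.
have [phi0 cZ] := opZ.1 _ (uk 0 isT).
exists k', phi, Z, (consf (phi (u 0)) v); split=> // [[|i] //|]; first exact: vk'.
by rewrite /= pcompA -upM e upM -!pcompA cZ.
Qed.

Lemma star_eqhom k n n' (e : n = n') u : eqhom P e ∘ star k n u = star k n' u.
Proof. by case: _ / e; apply: pcomp1m. Qed.

Lemma acts_eqhom k n n' m m' (e : n = n') (e' : m' = m) (X : phom P n' m') u :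
  acts k X u -> acts k (eqhom P e' ∘ (X ∘ eqhom P e)) u.
Proof. by move: X; case: n' / e; case: m / e' => X; rewrite pcompm1 pcomp1m. Qed.

(** The multiplication joins the nodes of its inputs and the unit adds a node 0, shifting the
    others; comultiplication and counit only repeat or drop a label. *)
Lemma gen_acts n m (g : escfm_gen n m) b k u :
  (forall i, i < n + b -> u i < k) -> acts k (gen M g ⊕ pid P b) u.
Proof.
case: g => uk.
- have u0k := uk 0 isT; have u1k := uk 1 isT.
  exists k, id, (join k (u 0) (u 1)), (consf (u 0) (u \o S \o S)).
  split; first exact: node_op_join.
    by case=> [|i] //= lt_ib; apply: uk.
  rewrite -/(mu b) /= upM -!pcompA (pcomp_pre (muN _)) -!pcompA.
  by rewrite mu_copy.
- exists k.+1, S, (et k), (consf 0 (S \o u)); split.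
  + exact: node_op_et.
  + by case=> [|i] //= lt_ib; apply: uk.
  + by rewrite star_up -etN.
- have u0k := uk 0 isT.
  apply: (@acts_eq _ _ _ _ _ (consf (u 0) u)).
    by case=> [|i] //= lt_ib; apply: uk.
  rewrite -/(de b) /= upM (pcomp_pre (deN _)) -!pcompA.
  by rewrite copy_de.
- apply: (@acts_eq _ _ _ _ _ (u \o S)); first by move=> i lt_ib; apply: uk.
  by rewrite -/(ep b) /= (pcomp_pre (epN _)) -pcompA copy_ep pcompm1.
Qed.

Lemma pid_acts k n u : (forall i, i < n -> u i < k) -> acts k (pid P n) u.
Proof. by move=> uk; apply: (acts_eq uk); rewrite pcomp1m. Qed.

(** The b idle wires leave room for the induction: a sum is g acting behind n idle wires, followed
    by f acting beside m' + b of them. *)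
Lemma teval_acts n m (t : term escfm_sig n m) b k u :
  (forall i, i < n + b -> u i < k) -> acts k (teval (gen M) t ⊕ pid P b) u.
Proof.
elim: t b k u =>
  {n m} [|||n m g|n m k g IHg f IHf|n m n' m' f IHf g IHg] b j u uj.
- by rewrite psum1; apply: pid_acts.
- by rewrite psum1; apply: pid_acts.
- apply: (@acts_eq _ _ _ _ _ (consf (u 1) (consf (u 0) (u \o S \o S)))).
    by case=> [|[|i]] //= lt_ib; apply: uj.
  rewrite -/(sw b) /= upM -!pcompA (pcomp_pre (swN _)) -!pcompA copyC.
  by rewrite upM -pcompA.
- exact: gen_acts.
- rewrite /= -(psum_pidM _ erefl).
  by apply: actsM => [|j' v vj']; [apply: IHf|apply: IHg].
- have -> : teval (gen M) (Tsum f g) ⊕ pid P b =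
      eqhom P (addnA m m' b) ∘
        ((teval (gen M) f ⊕ pid P (m' + b)) ∘
          (pid P n ⊕ (teval (gen M) g ⊕ pid P b)) ∘
            eqhom P (esym (addnA n n' b))).
    rewrite -psumM pcompm1 pcomp1m -psumA pcompA eqhomK.
    exact/esym/pcomp1m.
  apply: acts_eqhom; apply: actsM => [|j' v vj']; last exact: IHf.
  apply: acts_psum => [i lt_in|]; last first.
    by apply: IHg => i lt_i; apply: uj; rewrite -addnA ltn_add2l.
  by apply: uj; rewrite -addnA ltn_addr.
Qed.

Lemma teval_state m (t : term escfm_sig 0 m) : is_state (teval (gen M) t).
Proof.
(* The [star] from 0 nodes to 0 outputs is the identity of 0, so pushing the term through it
   rewrites the term itself. *)
have [//|k [phi [Z [v [[_ opZ] vk e]]]]] := @teval_acts _ _ t 0 0 id.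
have -> : teval (gen M) t = star k m v ∘ (Z ∘ etas 0).
  have := psum_pid0 (teval (gen M) t).
  rewrite (@eqhom_id P 0) pcompm1 => <-; rewrite -(star_eqhom k (addn0 m)).
  by rewrite (@pcompm1 P) -pcompA -e (@pcompm1 P).
apply: star_state => [i lt_im|]; first by apply: vk; rewrite addn0.
exact/opZ/etas_state.
Qed.

End Wires.

(** * Corelations between finite ordinals *)

Section OrdCorel.

Definition split_bij n m : bijective (@split n m) :=
  Bijective (@splitK n m) (@unsplitK n m).

Definition unsplit_bij n m : bijective (@unsplit n m) :=
  Bijective (@unsplitK n m) (@splitK n m).

Definition ord_braid n m (i : 'I_(n + m)) : 'I_(m + n) :=
  unsplit (sumC (split i)).

Lemma ord_braidK n m : cancel (@ord_braid n m) (@ord_braid m n).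
Proof. by move=> i; rewrite /ord_braid unsplitK sumCK splitK. Qed.

Definition ord_psum n m n' m' (a : corel 'I_n 'I_m) (b : corel 'I_n' 'I_m') :
    corel 'I_(n + n') 'I_(m + m') :=
  corel_comp (corel_comp (corel_bij (split_bij n n')) (corel_sum a b))
    (corel_bij (unsplit_bij m m')).

Definition ord_pdata : prop_data :=
  @PropData (fun n m => corel 'I_n 'I_m) (fun n => corel_id 'I_n)
    (fun n m k b a => corel_comp a b) ord_psum
    (fun n m => corel_bij (Bijective (@ord_braidK n m) (@ord_braidK m n))).

(* Labelings of the finite ordinals are given by functions on nat, so that no
   reindexing is needed between the two sides of a strict equality. *)
Definition ord_rel n m (a : phom ord_pdata n m) (f g : nat -> bool) : Prop :=
  compat a (fun i : 'I_n => f i) (fun j : 'I_m => g j).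

Lemma nat_extend n (F : 'I_n -> bool) : exists f : nat -> bool, F = fun i => f i.
Proof.
exists (fun i => if insub i is Some j then F j else false).
by apply/funext => i; rewrite valK.
Qed.

Lemma ord_rel_ext n m (a b : phom ord_pdata n m) :
  (forall f g, ord_rel a f g <-> ord_rel b f g) -> a = b.
Proof.
move=> ab; apply: corel_ext => f g.
by have [f' ->] := nat_extend f; have [g' ->] := nat_extend g; apply: ab.
Qed.

Lemma eq_ord_rel n m (a : phom ord_pdata n m) f g f' g' :
  (forall i, i < n -> f i = f' i) -> (forall j, j < m -> g j = g' j) ->
  ord_rel a f g -> ord_rel a f' g'.
Proof.
move=> ff' gg'; rewrite /ord_rel.
have -> : (fun i : 'I_n => f i) = fun i : 'I_n => f' i.
  by apply/funext => i; apply: ff'.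
by have -> : (fun j : 'I_m => g j) = fun j : 'I_m => g' j
  by apply/funext => j; apply: gg'.
Qed.

Lemma ord_rel_comp n m k (a : phom ord_pdata n m) (b : phom ord_pdata m k) f h :
  ord_rel (b ∘ a) f h <-> exists g, ord_rel a f g /\ ord_rel b g h.
Proof.
split=> [/compat_comp[g] | [g fgh]].
  by have [g' ->] := nat_extend g => fgh; exists g'.
by apply/compat_comp; exists (fun i : 'I_m => g i).
Qed.

Lemma ord_rel_id n f g :
  ord_rel (pid ord_pdata n) f g <-> forall i, i < n -> f i = g i.
Proof.
rewrite /ord_rel compat_bij; split=> [e i lt_in|e].
  exact: (congr1 (@^~ (Ordinal lt_in)) e).
by apply/funext => i; apply: e.
Qed.

Lemma ord_rel_eqhom n m (e : n = m) f g :
  ord_rel (eqhom ord_pdata e) f g <-> forall i, i < n -> f i = g i.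
Proof. by case: m / e; apply: ord_rel_id. Qed.

Lemma ord_rel_psum n m n' m' (a : phom ord_pdata n m) (b : phom ord_pdata n' m')
    f g :
  ord_rel (a ⊕ b) f g <->
  ord_rel a f g /\ ord_rel b (fun i => f (n + i)) (fun j => g (m + j)).
Proof.
rewrite /ord_rel compat_comp_bij.
rewrite (compat_bij_comp _ _ (@splitK _ _) (@unsplitK _ _)).
exact: compat_sum.
Qed.

Lemma ord_rel_braid n m f g : ord_rel (pbraid ord_pdata n m) f g <->
  (forall i, i < n -> f i = g (m + i)) /\ (forall j, j < m -> f (n + j) = g j).
Proof.
rewrite /ord_rel compat_bij; split=> [e|[fl fr]].
  split=> [i lt_in|j lt_jm].
    have := congr1 (@^~ (lshift m (Ordinal lt_in))) e => /= ->.
    by rewrite /ord_braid (unsplitK (inl (Ordinal lt_in))).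
  have := congr1 (@^~ (rshift n (Ordinal lt_jm))) e => /= ->.
  by rewrite /ord_braid (unsplitK (inr (Ordinal lt_jm))).
apply/funext => i /=; rewrite /ord_braid; case: splitP => j -> /=.
  exact: fl.
exact: fr.
Qed.

Lemma ord_comp1m n m (a : phom ord_pdata n m) : pid ord_pdata m ∘ a = a.
Proof.
apply: ord_rel_ext => f h; rewrite ord_rel_comp; split; last first.
  by move=> fh; exists h; rewrite ord_rel_id.
by move=> [g [fg /ord_rel_id gh]]; apply: eq_ord_rel fg.
Qed.

Lemma ord_compm1 n m (a : phom ord_pdata n m) : a ∘ pid ord_pdata n = a.
Proof.
apply: ord_rel_ext => f h; rewrite ord_rel_comp; split; last first.
  by move=> fh; exists f; rewrite ord_rel_id.
by move=> [g [/ord_rel_id fg gh]]; apply: eq_ord_rel gh => // i /fg ->.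
Qed.

Lemma ord_psum1 n m :
  pid ord_pdata n ⊕ pid ord_pdata m = pid ord_pdata (n + m).
Proof.
apply: ord_rel_ext => f h; rewrite ord_rel_psum !ord_rel_id; split.
  move=> [e e'] i lt_i; have [/e //|le_ni] := ltnP i n.
  by have := e' (i - n); rewrite subnKC // => ->; lia.
by move=> e; split=> i lt_i; apply: e; lia.
Qed.

Lemma ord_eqhomM n m k (e : n = m) (e' : m = k) :
  eqhom ord_pdata e' ∘ eqhom ord_pdata e = eqhom ord_pdata (etrans e e').
Proof. by case: k / e'; apply: ord_comp1m. Qed.

Lemma ord_eqhom_id n (e : n = n) : eqhom ord_pdata e = pid ord_pdata n.
Proof. by rewrite (eq_irrelevance e erefl). Qed.

Lemma ord_psum_eqhom n m n' m' (e : n = m) (e' : n' = m') :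
  eqhom ord_pdata e ⊕ eqhom ord_pdata e' =
  eqhom ord_pdata (etrans (congr1 (addn n) e') (congr1 (addn^~ m') e)).
Proof. by case: m / e; case: m' / e'; exact: (ord_psum1 n n'). Qed.

Lemma ord_rel_eqhoml n m k (a : phom ord_pdata n m) (e : m = k) f h :
  ord_rel (eqhom ord_pdata e ∘ a) f h <-> ord_rel a f h.
Proof. by case: k / e; rewrite ord_comp1m. Qed.

Lemma ord_rel_eqhomr n m k (a : phom ord_pdata m k) (e : n = m) f h :
  ord_rel (a ∘ eqhom ord_pdata e) f h <-> ord_rel a f h.
Proof. by case: m / e a => a; rewrite ord_compm1. Qed.

(** Axioms between [eqhom]s hold by irrelevance of equality proofs; the others are compared through
    labelings, on which an [eqhom] acts as the identity. *)
Lemma ord_propP : smc_upto (@eq_rel (smc_of_data ord_pdata)).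
Proof.
have addE (f : nat -> bool) a b :
    (fun i => f (a + (b + i))) = fun i => f (a + b + i).
  by apply/funext => i; rewrite addnA.
have eqhom_pid n : pid ord_pdata n = eqhom ord_pdata erefl by [].
split; rewrite /eq_rel; cbn [obj hom idm compm uobj tobj tensm assoc assocV
  lunit lunitV runit runitV braid smc_of_data].
- move=> n m k l a b c; apply: ord_rel_ext => f h; rewrite !ord_rel_comp; split.
    by move=> [g [/ord_rel_comp[g' [? ?]] ?]]; exists g';
      rewrite ord_rel_comp; eauto.
  by move=> [g [? /ord_rel_comp[g' [? ?]]]]; exists g';
    rewrite ord_rel_comp; eauto.
- exact: ord_comp1m.
- exact: ord_compm1.
- exact: ord_psum1.
- move=> n m k n' m' k' a b a' b'; apply: ord_rel_ext => f h.
  rewrite ord_rel_psum !ord_rel_comp; split.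
    move=> [[g [ag bg]] [g' [ag' bg']]].
    (* The two intermediate labelings side by side, the second shifted past the first m wires. *)
    exists (fun i => if i < m then g i else g' (i - m)); rewrite !ord_rel_psum.
    split; split.
    + by apply: eq_ord_rel ag => // i ->.
    + by apply: eq_ord_rel ag' => // i _; rewrite ltnNge leq_addr addKn.
    + by apply: eq_ord_rel bg => // i ->.
    + by apply: eq_ord_rel bg' => // i _; rewrite ltnNge leq_addr addKn.
  by move=> [g [/ord_rel_psum[? ?] /ord_rel_psum[? ?]]]; split; eauto.
- by move=> a b c; rewrite ord_eqhomM ord_eqhom_id.
- by move=> a b c; rewrite ord_eqhomM ord_eqhom_id.
- by move=> a; rewrite ord_eqhomM ord_eqhom_id.
- by move=> a; rewrite ord_eqhomM ord_eqhom_id.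
- by move=> a; rewrite ord_eqhomM ord_eqhom_id.
- by move=> a; rewrite ord_eqhomM ord_eqhom_id.
- move=> n m k n' m' k' a b c; apply: ord_rel_ext => f h.
  rewrite ord_rel_eqhoml ord_rel_eqhomr !ord_rel_psum !addE; tauto.
- move=> n m a; apply: ord_rel_ext => f h.
  rewrite ord_rel_eqhoml ord_rel_eqhomr ord_rel_psum ord_rel_id.
  by split=> [[]|].
- move=> n m a; apply: ord_rel_ext => f h.
  rewrite ord_rel_eqhoml ord_rel_eqhomr ord_rel_psum ord_rel_id.
  by split=> [[]|].
- move=> n m n' m' a b; apply: ord_rel_ext => f h; rewrite !ord_rel_comp; split.
    move=> [g [/ord_rel_psum[ag bg] /ord_rel_braid[e e']]].
    exists (fun i => if i < m then f (n + i) else f (i - m)).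
    rewrite ord_rel_braid ord_rel_psum; (split; [split=> [i lt_i|j lt_j]|split]).
    + by rewrite ltnNge leq_addr addKn.
    + by rewrite lt_j.
    + by apply: eq_ord_rel bg => // i ->.
    + by apply: eq_ord_rel ag => // i _; rewrite ltnNge leq_addr addKn.
  move=> [g [/ord_rel_braid[e e'] /ord_rel_psum[bg ag]]].
  exists (fun i => if i < n' then h (m' + i) else h (i - n')).
  rewrite ord_rel_braid ord_rel_psum; (split; [split|split=> [i lt_i|j lt_j]]).
  + by apply: eq_ord_rel ag => i lt_i; rewrite ?lt_i // e.
  + by apply: eq_ord_rel bg => i lt_i; rewrite ?ltnNge ?leq_addr ?addKn // e'.
  + by rewrite lt_i.
  + by rewrite ltnNge leq_addr addKn.
- move=> n m; apply: ord_rel_ext => f h; rewrite ord_rel_comp ord_rel_id; split.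
    move=> [g [/ord_rel_braid[e1 e2] /ord_rel_braid[e3 e4]]] i lt_i.
    have [lt_in|le_ni] := ltnP i n; first by rewrite e1 // e4.
    by rewrite -(subnKC le_ni) e2 ?e3 //; lia.
  move=> e; exists (fun i => if i < m then f (n + i) else f (i - m)).
  rewrite !ord_rel_braid; split; split=> i lt_i.
  + by rewrite ltnNge leq_addr addKn.
  + by rewrite lt_i.
  + by rewrite lt_i e //; lia.
  + by rewrite ltnNge leq_addr /= addKn e //; lia.
- move=> a b; rewrite (eqhom_pid a) (eqhom_pid b) !ord_psum_eqhom.
  by rewrite ord_eqhomM; congr eqhom; apply: eq_irrelevance.
- move=> a b c d; rewrite (eqhom_pid a) (eqhom_pid d) !ord_psum_eqhom.
  by rewrite !ord_eqhomM; congr eqhom; apply: eq_irrelevance.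
- move=> n; apply: ord_rel_ext => f h.
  rewrite ord_rel_eqhoml ord_rel_braid ord_rel_eqhom addn0.
  by split=> [[]|].
- move=> a b c; apply: ord_rel_ext => f h.
  rewrite ord_rel_eqhoml ord_rel_eqhomr ord_rel_comp ord_rel_braid; split.
    move=> [e e'].
    (* The labels between the two crossings, on b + a + c: those of b and a come from the output
       [h], where the block a stands c places further on, and those of c from the input [f]. *)
    exists (fun i => if i < b + a then h (if i < b then i else c + i) else f i).
    rewrite ord_rel_eqhoml !ord_rel_psum !ord_rel_braid !ord_rel_id.
    have cE i j l : (c + (b + i) < b + j) = (c + i < j) by lia.
    (split; split; [split=> [i lt_i|j lt_j]|move=> i lt_i|move=> i lt_i
      |split=> [i lt_i|j lt_j]]).
    + rewrite ltn_add2l lt_i ltnNge leq_addr /= e //; congr h; lia.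
    + by rewrite ltn_addr // lt_j e' //; lia.
    + by rewrite (addnC a b) ltnNge leq_addr.
    + by rewrite ltn_addr // lt_i.
    + rewrite ltn_add2l lt_i ltnNge leq_addr /=; congr h; lia.
    + rewrite addnA ltnNge leq_addr /= -e' -?addnA; [congr f; lia|lia].
  move=> [g [/ord_rel_eqhoml/ord_rel_psum[/ord_rel_braid[e1 e2] /ord_rel_id e3]]].
  move=> /ord_rel_psum[/ord_rel_id e4 /ord_rel_braid[e5 e6]].
  split=> [i lt_i|j lt_j]; first by rewrite e1 // e5 // addnA.
  have [lt_jb|le_bj] := ltnP j b; first by rewrite e2 // e4.
  rewrite -{2}(subnKC le_bj) -e6; last by lia.
  have := e3 (j - b); rewrite -!addnA (addnC b) addnA => <-; last by lia.
  by congr f; lia.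
Qed.

Definition ord_prop : prop := MkProp ord_propP.

End OrdCorel.

(** * States of a semantic model *)

(* Abstracting from corelations keeps rewriting from unfolding them. *)
Record semantics (P : prop) := Semantics {
  rel : forall n m, phom P n m -> (nat -> bool) -> (nat -> bool) -> Prop;
  spider : forall n m, phom P n m;
  rel_ext : forall n m (a b : phom P n m),
    (forall f g, rel a f g <-> rel b f g) -> a = b;
  rel_comp : forall n m k (a : phom P n m) (b : phom P m k) f h,
    rel (b ∘ a) f h <-> exists g, rel a f g /\ rel b g h;
  rel_id : forall n f g, rel (pid P n) f g <-> forall i, i < n -> f i = g i;
  rel_psum : forall n m n' m' (a : phom P n m) (b : phom P n' m') f g,
    rel (a ⊕ b) f g <->
    rel a f g /\ rel b (fun i => f (n + i)) (fun j => g (m + j));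
  rel_braid : forall n m f g, rel (pbraid P n m) f g <->
    (forall i, i < n -> f i = g (m + i)) /\ (forall j, j < m -> f (n + j) = g j);
  rel_spider : forall n m f g, rel (spider n m) f g <->
    exists c, (forall i, i < n -> f i = c) /\ (forall j, j < m -> g j = c);
  rel_classes : forall m (a : phom P 0 m), exists u : nat -> nat,
    (forall i, i < m -> u i < m) /\
    forall f g, rel a f g <-> exists F, forall i, i < m -> g i = F (u i)
}.

(** * The Frobenius structure on labelings *)

Section Semantics.
Variables (P : prop) (s : semantics P).

Definition sem_gen n m (_ : escfm_gen n m) : phom P n m := spider s n m.

Lemma rel_mu f g : rel s (spider s 2 1) f g <-> f 0 = g 0 /\ f 1 = g 0.
Proof.
rewrite rel_spider; split=> [[c [fc gc]]|[f0 f1]].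
  by rewrite !fc ?gc.
by exists (g 0); split=> [[|[]]|[]].
Qed.

Lemma rel_delta f g : rel s (spider s 1 2) f g <-> f 0 = g 0 /\ f 0 = g 1.
Proof.
rewrite rel_spider; split=> [[c [fc gc]]|[f0 f1]].
  by rewrite !gc ?fc.
by exists (f 0); split=> [[]|[|[]]].
Qed.

Lemma rel_eta f g : rel s (spider s 0 1) f g.
Proof. by rewrite rel_spider; exists (g 0); split=> [|[]]. Qed.

Lemma rel_eps f g : rel s (spider s 1 0) f g.
Proof. by rewrite rel_spider; exists (f 0); split=> [[]|]. Qed.

Lemma rel_pid1 f g : rel s (pid P 1) f g <-> f 0 = g 0.
Proof. by rewrite rel_id; split=> [/(_ 0 isT)|? []]. Qed.

Lemma rel_swap f g : rel s (pbraid P 1 1) f g <-> f 0 = g 1 /\ f 1 = g 0.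
Proof.
rewrite rel_braid; split=> [[/(_ 0 isT) e /(_ 0 isT) e'] //|[e e']].
by split=> -[].
Qed.

Lemma rel_psum1r n m (a : phom P n m) f g : rel s (a ⊕ pid P 1) f g <->
  rel s a f g /\ f n = g m.
Proof. by rewrite rel_psum rel_pid1 !addn0. Qed.

Lemma rel_psum1l n m (a : phom P n m) f g : rel s (pid P 1 ⊕ a) f g <->
  f 0 = g 0 /\ rel s a (f \o S) (g \o S).
Proof. by rewrite rel_psum rel_pid1. Qed.

Lemma sem_genP n m (t t' : term escfm_sig n m) : escfm_eqn t t' ->
  teval sem_gen t = teval sem_gen t'.
Proof.
have relE := (rel_mu, rel_delta, rel_pid1, rel_swap).
have E1 (Q : Prop) : Q -> Q <-> True by [].
have relT f g := (E1 _ (rel_eta f g), E1 _ (rel_eps f g)).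
have rel3 := (rel_psum1r (spider s 2 1), rel_psum1l (spider s 2 1),
  rel_psum1r (spider s 0 1), rel_psum1r (spider s 1 0),
  rel_psum1r (spider s 1 2), rel_psum1l (spider s 1 2)).
(* A labeling of the intermediate wires is given by its first three values, as no composite in the
   equations has more than three such wires. *)
have W (Q : (nat -> bool) -> Prop) x y z :
  Q (consf x (consf y (consf z xpredT))) -> exists g, Q g.
  by exists (consf x (consf y (consf z xpredT))).
case; cbn [teval]; rewrite /sem_gen; apply: (@rel_ext _ s) => f h; rewrite ?relE.
- rewrite !rel_comp; split; move=> [g]; rewrite !rel3 !relE /= => e.
    apply: (W _ (h 0) (h 0) true).
    rewrite /= !rel3 !relE /=; intuition congruence.
  apply: (W _ (h 0) (h 0) true).
  rewrite /= !rel3 !relE /=; intuition congruence.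
- rewrite rel_comp; split=> [[g]|e].
    rewrite rel3 relE relT /=; intuition congruence.
  apply: (W _ (h 0) (h 0) true).
  rewrite /= rel3 !relE relT /=; intuition congruence.
- rewrite rel_comp; split=> [[g]|e].
    rewrite !relE /=; intuition congruence.
  apply: (W _ (f 1) (f 0) true).
  rewrite /= !relE /=; intuition congruence.
- rewrite !rel_comp; split; move=> [g]; rewrite !rel3 !relE /= => e.
    apply: (W _ (f 0) (f 0) true).
    rewrite /= !rel3 !relE /=; intuition congruence.
  apply: (W _ (f 0) (f 0) true).
  rewrite /= !rel3 !relE /=; intuition congruence.
- rewrite rel_comp; split=> [[g]|e].
    rewrite rel3 relE relT /=; intuition congruence.
  apply: (W _ (f 0) (f 0) true).
  rewrite /= rel3 !relE relT /=; intuition congruence.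
- rewrite rel_comp; split=> [[g]|e].
    rewrite !relE /=; intuition congruence.
  apply: (W _ (h 1) (h 0) true).
  rewrite /= !relE /=; intuition congruence.
- rewrite !rel_comp; split; move=> [g]; rewrite ?rel3 !relE /= => e.
    apply: (W _ (f 0) true true).
    rewrite /= !relE /=; intuition congruence.
  apply: (W _ (f 0) (f 0) (f 0)).
  rewrite /= !rel3 !relE /=; intuition congruence.
- rewrite !rel_comp; split; move=> [g]; rewrite ?rel3 !relE /= => e.
    apply: (W _ (f 0) (f 0) (f 0)).
    rewrite /= !rel3 !relE /=; intuition congruence.
  apply: (W _ (f 0) true true).
  rewrite /= !relE /=; intuition congruence.
- rewrite rel_comp; split=> [[g]|e].
    rewrite !relE /=; intuition congruence.
  apply: (W _ (f 0) (f 0) true).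
  rewrite /= !relE /=; intuition congruence.
(* Extra law: the middle wire may carry any label, so the composite relates all labelings, as does
   the identity of 0. *)
- rewrite rel_comp rel_id; split=> // _.
  by exists xpredT; split; [apply: rel_eta|apply: rel_eps].
Qed.

Definition sem_model : model P := Model sem_genP.

Local Notation M := sem_model.

(** * Labelings of copies, relabellings and states *)

Lemma rel_up n m (a : phom P n m) f g :
  rel s (up a) f g <-> f 0 = g 0 /\ rel s a (f \o S) (g \o S).
Proof. exact: rel_psum1l. Qed.

Lemma rel_loc n m k (a : phom P n m) f g : rel s (a ⊕ pid P k) f g <->
  rel s a f g /\ forall i, i < k -> f (n + i) = g (m + i).
Proof. by rewrite rel_psum rel_id. Qed.

Lemma rel_de k f g : rel s (de M k) f g <->
  rel s (spider s 1 2) f g /\ forall i, i < k -> f i.+1 = g i.+2.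
Proof. exact (@rel_loc _ _ k (spider s 1 2) f g). Qed.

Lemma rel_sw k f g : rel s (sw P k) f g <->
  rel s (pbraid P 1 1) f g /\ forall i, i < k -> f i.+2 = g i.+2.
Proof. exact (@rel_loc _ _ k (pbraid P 1 1) f g). Qed.

Lemma rel_ep k f g : rel s (ep M k) f g <-> forall i, i < k -> f i.+1 = g i.
Proof.
apply: iff_trans (_ : rel s (spider s 1 0) f g /\ _ <-> _).
  exact (@rel_loc _ _ k (spider s 1 0) f g).
by split=> [[]|e] //; split=> //; apply: rel_eps.
Qed.

Lemma rel_et k f g : rel s (et M k) f g <-> forall i, i < k -> f i = g i.+1.
Proof.
apply: iff_trans (_ : rel s (spider s 0 1) f g /\ _ <-> _).
  exact (@rel_loc _ _ k (spider s 0 1) f g).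
by split=> [[]|e] //; split=> //; apply: rel_eta.
Qed.

Lemma rel_copy k i f g : i < k ->
  rel s (copy M k i) f g <-> g 0 = f i /\ forall j, j < k -> f j = g j.+1.
Proof.
elim: k i f g => // k IHk [|i] f g lt_ik.
  rewrite rel_de rel_delta.
  split=> [[[e e'] e'']|[e e']].
    by rewrite -e; split=> // -[|j] lt_jk; rewrite ?e' //; apply: e''.
  by rewrite -e -e' //; split=> // j lt_jk; apply: e'.
rewrite copySS rel_comp; split.
  move=> [h [/rel_up[e /(IHk _ _ _ lt_ik)[/= e' e'']]]].
  move=> /rel_sw[/rel_swap[e1 e2] e3].
  rewrite -e2 e'; split=> // -[|j] lt_jk; first by rewrite e.
  by rewrite -e3 // -e''.
move=> [e e']; exists (consf (g 1) (consf (g 0) (g \o S \o S))); split.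
  apply/rel_up; split; first exact: e'.
  by apply/IHk => //; split=> //= j lt_jk; apply: e'.
by apply/rel_sw; rewrite rel_swap.
Qed.

Lemma rel_star0 k u f g : rel s (star M k 0 u) f g.
Proof.
elim: k f => [|k IHk] f; first exact/rel_id.
rewrite star0S rel_comp; exists (f \o S); split=> //.
exact/rel_ep.
Qed.

Lemma rel_star k n u f g : (forall i, i < n -> u i < k) ->
  rel s (star M k n u) f g <-> forall i, i < n -> g i = f (u i).
Proof.
elim: n u f g => [|n IHn] u f g uk; first by split=> // _; apply: rel_star0.
have u'k i : i < n -> (u \o S) i < k by move=> lt_in; apply: uk.
rewrite starSn rel_comp; split.
  move=> [h [/(rel_copy _ _ (uk 0 isT))[e e']]].
  move=> /rel_up[e1 /(IHn _ _ _ u'k) e2] [_|i lt_in].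
    by rewrite -e1.
  by rewrite [LHS](e2 i lt_in) /= -e' //; apply: uk.
move=> e; exists (consf (f (u 0)) f).
split; first exact/(rel_copy _ _ (uk 0 isT)).
apply/rel_up; split; first by rewrite e.
by apply/IHn => // i lt_in; apply: e.
Qed.

Lemma rel_etas k f g : rel s (etas M k) f g.
Proof.
elim: k g => [|k IHk] g; first exact/rel_id.
rewrite etasS rel_comp; exists (g \o S); split=> //.
exact/rel_et.
Qed.

Lemma rel_state k n u f g : (forall i, i < n -> u i < k) ->
  rel s (star M k n u ∘ etas M k) f g <->
  exists F, forall i, i < n -> g i = F (u i).
Proof.
move=> uk; rewrite rel_comp; split=> [[h [_ /(rel_star _ _ uk) e]]|[h e]].
  by exists h.
by exists h; split; [apply: rel_etas|apply/rel_star].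
Qed.

Lemma sem_state n (a : phom P 0 n) : is_state M a.
Proof.
have [u [un aE]] := rel_classes s a; exists n, u; split=> //.
by apply: (@rel_ext _ s) => f g; rewrite aE rel_state.
Qed.

(** Two-valued labelings separate classes, so the relation of a state determines which outputs share
    a node. *)
Lemma state_labels_eq k k' n u v :
  (forall i, i < n -> u i < k) -> (forall i, i < n -> v i < k') ->
  star M k n u ∘ etas M k = star M k' n v ∘ etas M k' ->
  forall i j, i < n -> j < n -> (u i == u j) = (v i == v j).
Proof.
have sub l l' (w w' : nat -> nat) i j :
    (forall i, i < n -> w i < l) -> (forall i, i < n -> w' i < l') ->
    star M l n w ∘ etas M l = star M l' n w' ∘ etas M l' ->
    i < n -> j < n -> w i = w j -> w' i = w' j.
  move=> wl w'l' e lt_in lt_jn wij.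
  (* The indicator of the label [w' i] is an admissible labeling of the second state, hence of the
     first, where outputs i and j share a node. *)
  have : rel s (star M l' n w' ∘ etas M l') xpredT (fun a => w' a == w' i).
    by apply/rel_state => //; exists (fun a => a == w' i).
  rewrite -e rel_state // => -[F FE].
  by apply/esym/eqP; rewrite (FE j) // -wij -FE.
move=> uk vk' e i j lt_in lt_jn; apply/eqP/eqP.
  exact: (sub _ _ _ _ _ _ uk vk' e).
exact: (sub _ _ _ _ _ _ vk' uk (esym e)).
Qed.

End Semantics.

(** * Interpretation of Th(ESCFM) *)

Definition ord_spider n m : phom ord_pdata n m :=
  exist _ (preim_partition (fun _ : 'I_n + 'I_m => tt) [set: 'I_n + 'I_m])
    (preim_partitionP _ _).

Lemma ord_rel_spider n m f g : ord_rel (ord_spider n m) f g <->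
  exists c, (forall i, i < n -> f i = c) /\ (forall j, j < m -> g j = c).
Proof.
split=> [fg|[c [fc gc]] u v _]; last first.
  have cE w : copair (fun i : 'I_n => f i) (fun j : 'I_m => g j) w = c.
    by case: w => i /=; [apply: fc|apply: gc].
  by rewrite !cE.
pose l := copair (fun i : 'I_n => f i) (fun j : 'I_m => g j).
have lE u v : l u = l v by apply: fg; rewrite pblock_preim.
case: (pickP {: 'I_n + 'I_m}) => [u _|no]; last first.
  exists true; split=> i lt_i.
    by have := no (inl (Ordinal lt_i)).
  by have := no (inr (Ordinal lt_i)).
exists (l u); split=> i lt_i.
  exact: (lE (inl (Ordinal lt_i)) u).
exact: (lE (inr (Ordinal lt_i)) u).
Qed.

Lemma ord_rel_classes m (a : phom ord_pdata 0 m) : exists u : nat -> nat,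
  (forall i, i < m -> u i < m) /\
  forall f g, ord_rel a f g <-> exists F, forall i, i < m -> g i = F (u i).
Proof.
have pa := svalP a.
(* A representative of each class: the pick depends on the block alone, so equivalent wires receive
   the same one. *)
pose r (j : 'I_m) : 'I_m :=
  if [pick i | inr i \in pblock (sval a) (inr j)] is Some i then i else j.
have rP j : inr (r j) \in pblock (sval a) (inr j).
  by rewrite /r; case: pickP => // /(_ j); rewrite mem_pblockT.
have rE i j : inr j \in pblock (sval a) (inr i) -> r i = r j.
  rewrite -eq_pblockT // /r => /eqP ->.
  by case: pickP => // /(_ j); rewrite mem_pblockT.
exists (fun i => if insub i is Some j then val (r j) else i); split.
  by move=> i lt_im; rewrite insubT ltn_ord.
move=> f g; split=> [fg|[F gF] u v].
  (* An admissible labeling serves as its own [F], since it agrees at a wire and at the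
     representative of that wire. *)
  exists g => i lt_im; rewrite insubT /=.
  exact: (fg (inr (Ordinal lt_im)) (inr (r (Ordinal lt_im)))).
case: u v => [[]|i] // [[]|j] //= /rE rij.
by rewrite !gF // !valK rij.
Qed.

Definition ord_sem : semantics ord_prop :=
  @Semantics ord_prop ord_rel ord_spider ord_rel_ext ord_rel_comp ord_rel_id
    ord_rel_psum ord_rel_braid ord_rel_spider ord_rel_classes.

Definition data_mor_comp (P Q T : prop_data) (g : data_mor Q T)
  (f : data_mor P Q) : data_mor P T.
Proof.
exists (fun n m x => g _ _ (f _ _ x)).
- by move=> n; rewrite !pmap1.
- by move=> *; rewrite !pmapM.
- by move=> *; rewrite !pmapD.
- by move=> n m; rewrite !pmap_braid.
Defined.

Definition Th_gen n m (g : escfm_gen n m) : phom Th_ESCFM n m :=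
  coeq_proj (eqn_lhs escfm) (eqn_rhs escfm) _ _ (@free_gen escfm_sig _ _ g).

Lemma teval_Th_gen n m (t : term escfm_sig n m) :
  teval Th_gen t = coeq_proj (eqn_lhs escfm) (eqn_rhs escfm) _ _ (term_class t).
Proof.
rewrite -(free_ext_class Th_gen); apply: free_ext_uniq => k l g.
by rewrite free_ext_gen.
Qed.

Lemma Th_genP n m (t t' : term escfm_sig n m) : escfm_eqn t t' ->
  teval Th_gen t = teval Th_gen t'.
Proof.
move=> tt'; rewrite !teval_Th_gen.
pose e : eqn_sig escfm n m := exist _ (t, t') tt'.
have := coeq_projE (eqn_lhs escfm) (eqn_rhs escfm) (free_gen e).
by rewrite /eqn_lhs /eqn_rhs !free_ext_gen.
Qed.

Definition Th_model : model Th_ESCFM := Model Th_genP.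

Lemma Th_teval n m (x : phom Th_ESCFM n m) :
  exists t, x = teval (gen Th_model) t.
Proof.
(* One representative for the quotient by the equations, one for the quotient of terms in the free
   prop. *)
exists (prepr (prepr x)); rewrite teval_Th_gen.
by rewrite /term_class preprK; apply/esym/preprK.
Qed.

(** * The morphism from Th(ESCFM) to a model *)

Section Interpretation.
Variables (P : prop) (M : model P).

(** Both composites start from the free prop on the equations, so they need only agree on its
    generators; there the model satisfies the equation. *)
Lemma free_ext_eqn n m (x y : phom (free_prop escfm_sig) n m) :
  coeq_rel (eqn_lhs escfm) (eqn_rhs escfm) x y ->
  free_ext (gen M) _ _ x = free_ext (gen M) _ _ y.
Proof.
case=> z [-> ->].
apply: (free_ext_uniq (f := data_mor_comp (free_ext (gen M)) (eqn_lhs escfm))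
          (g := data_mor_comp (free_ext (gen M)) (eqn_rhs escfm))).
move=> k l e.
transitivity (free_ext (gen M) _ _ (term_class (sval e).1)).
  by congr (free_ext (gen M) _ _ _); exact: free_ext_gen.
transitivity (free_ext (gen M) _ _ (term_class (sval e).2)); last first.
  by congr (free_ext (gen M) _ _ _); apply/esym; exact: free_ext_gen.
by rewrite !free_ext_class; apply: genP; apply: svalP e.
Qed.

Definition interp : prop_mor Th_ESCFM P := quot_lift free_ext_eqn.

Lemma interp_teval n m (t : term escfm_sig n m) :
  interp _ _ (teval (gen Th_model) t) = teval (gen M) t.
Proof. by rewrite teval_Th_gen quot_liftE free_ext_class. Qed.

End Interpretation.

Section InterpWires.
Variables (P : prop) (M : model P).
Local Notation G := (interp M).

Lemma interp_gen n m (g : escfm_gen n m) : G _ _ (gen Th_model g) = gen M g.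
Proof. exact: (interp_teval M (Tgen (g : escfm_sig n m))). Qed.

Lemma interp_up n m (t : phom Th_ESCFM n m) : G _ _ (up t) = up (G _ _ t).
Proof. by rewrite (pmapD G (pid _ 1)) pmap1. Qed.

Lemma interp_loc a b k (g : escfm_gen a b) :
  G _ _ (gen Th_model g ⊕ pid Th_ESCFM k) = gen M g ⊕ pid P k.
Proof. by rewrite pmapD pmap1 interp_gen. Qed.

Lemma interp_sw k : G _ _ (sw Th_ESCFM k) = sw P k.
Proof. by rewrite /sw (pmapD G (pbraid _ 1 1)) pmap1 (pmap_braid G 1 1). Qed.

Lemma interp_copy k i : G _ _ (copy Th_model k i) = copy M k i.
Proof.
elim: k i => [i|k IHk [|i]]; first exact: (interp_loc 0 gen_eta).
  exact: (interp_loc k gen_delta).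
by rewrite !copySS pmapM interp_sw interp_up IHk.
Qed.

Lemma interp_star k n u : G _ _ (star Th_model k n u) = star M k n u.
Proof.
elim: n u => [|n IHn] u; last by rewrite !starSn pmapM interp_up IHn interp_copy.
elim: k => [|k IHk]; first exact: pmap1.
by rewrite !star0S pmapM IHk; congr (_ ∘ _); exact: (interp_loc k gen_eps).
Qed.

Lemma interp_etas k : G _ _ (etas Th_model k) = etas M k.
Proof.
elim: k => [|k IHk]; first exact: pmap1.
by rewrite !etasS pmapM IHk; congr (_ ∘ _); exact: (interp_loc k gen_eta).
Qed.

Lemma interp_bend n m (t : phom Th_ESCFM n.+1 m) :
  G _ _ (bend Th_model t) = bend M (G _ _ t).
Proof.
rewrite /bend !pmapM interp_up.
congr (_ ∘ (_ ∘ _)); first exact: (interp_loc n gen_delta).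
exact: (interp_loc n gen_eta).
Qed.

Lemma interp_unbend n m (t : phom Th_ESCFM n m.+1) :
  G _ _ (unbend Th_model t) = unbend M (G _ _ t).
Proof.
rewrite /unbend pmapM interp_up !capE pmapM.
congr ((_ ∘ _) ∘ _); first exact: (interp_loc m gen_eps).
exact: (interp_loc m gen_mu).
Qed.

End InterpWires.

Lemma Th_state m (w : phom Th_ESCFM 0 m) : is_state Th_model w.
Proof. by have [t ->] := Th_teval w; apply: teval_state. Qed.

Local Notation G := (interp (sem_model ord_sem)).

(** * Fullness and faithfulness of the interpretation *)

Lemma interp_full n m (a : phom ord_prop n m) :
  exists t : phom Th_ESCFM n m, G _ _ t = a.
Proof.
elim: n m a => [|n IHn] m a.
  have [k [u [uk ->]]] := sem_state ord_sem a.
  exists (star Th_model k m u ∘ etas Th_model k).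
  by rewrite pmapM interp_star interp_etas.
have [t tE] := IHn _ (bend (sem_model ord_sem) a).
by exists (unbend Th_model t); rewrite interp_unbend tE bendK.
Qed.

(** After bending all inputs, the image of a state determines the equalities among its labels, and
    these determine the state through [pat]. *)
Lemma interp_faithful n m (t t' : phom Th_ESCFM n m) :
  G _ _ t = G _ _ t' -> t = t'.
Proof.
elim: n m t t' => [|n IHn] m t t'.
  have [k [u [uk ->]]] := Th_state t; have [l [v [vl ->]]] := Th_state t'.
  rewrite !pmapM !interp_star !interp_etas => /(state_labels_eq uk vl) uv.
  by rewrite !star_pat //; apply: eq_pat.
move=> e; rewrite -(bendK Th_model t) -(bendK Th_model t').
by congr unbend; apply: IHn; rewrite !interp_bend e.
Qed.

(** * Fully faithful functors *)

Section FullyFaithful.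
Local Open Scope smc_scope.
Variables (C D : smcat) (G : smfunctor C D).
Hypothesis fullG : forall (a b : C) (h : hom (G a) (G b)), exists f, fmap G f = h.
Hypothesis faithfulG : forall (a b : C) (f g : hom a b),
  fmap G f = fmap G g -> f = g.

Lemma comp_pre (a b c : D) (f : hom a b) (g : hom b c) h : g ∘ f = h ->
  forall d (x : hom d a), g ∘ (f ∘ x) = h ∘ x.
Proof. by move=> <- d x; rewrite compA. Qed.

Lemma reflect_iso (a b : C) (f : hom a b) : is_iso (fmap G f) -> is_iso f.
Proof.
move=> [g' [g'f fg']]; have [g gE] := fullG g'; exists g.
by split; apply: faithfulG; rewrite fmapM gE fmap1.
Qed.

Variables (r : D -> C) (i : forall d, hom (G (r d)) d).
Variable j : forall d, hom d (G (r d)).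
Hypothesis iK : forall d, j d ∘ i d = idm _.
Hypothesis jK : forall d, i d ∘ j d = idm _.
Variable p : forall a b : C, hom (G a) (G b) -> hom a b.
Hypothesis pK : forall (a b : C) (h : hom (G a) (G b)), fmap G (p h) = h.
Variable muV : forall a b : C, hom (G (tobj a b)) (tobj (G a) (G b)).
Hypothesis muK : forall a b, muV a b ∘ fmu G a b = idm _.
Hypothesis muVK : forall a b, fmu G a b ∘ muV a b = idm _.
Variable epsV : hom (G uobj) uobj.
Hypothesis epsK : epsV ∘ feps G = idm _.
Hypothesis epsVK : feps G ∘ epsV = idm _.

Let iKp d e (x : hom e _) : j d ∘ (i d ∘ x) = x.
Proof. by rewrite (comp_pre (iK d)) comp1m. Qed.

Let jKp d e (x : hom e d) : i d ∘ (j d ∘ x) = x.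
Proof. by rewrite (comp_pre (jK d)) comp1m. Qed.

Let muKp a b e (x : hom e _) : muV a b ∘ (fmu G a b ∘ x) = x.
Proof. by rewrite (comp_pre (muK a b)) comp1m. Qed.

Lemma fmap_tens (a b c d : C) (f : hom a b) (g : hom c d) :
  fmap G (f ⊗ g) = fmu G b d ∘ ((fmap G f ⊗ fmap G g) ∘ muV a c).
Proof. by rewrite compA fmuN -compA muVK compm1. Qed.

(** The coherence of [G] solved for the image of the associator; the next three lemmas do the same
    for the unitors and the braiding. *)
Lemma fmap_assoc (a b c : C) : muV a (b ⊠ c) ∘ fmap G (assoc a b c) =
  (idm _ ⊗ fmu G b c) ∘ (assoc _ _ _ ∘ ((muV a b ⊗ idm _) ∘ muV (a ⊠ b) c)).
Proof.
have e := fmu_assoc G a b c.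
have {e} : fmap G (assoc a b c) ∘
      (fmu G (a ⊠ b) c ∘ ((fmu G a b ⊗ idm _) ∘
        ((muV a b ⊗ idm _) ∘ muV (a ⊠ b) c)))
  = fmu G a (b ⊠ c) ∘ ((idm _ ⊗ fmu G b c) ∘
      (assoc _ _ _ ∘ ((muV a b ⊗ idm _) ∘ muV (a ⊠ b) c))).
  by rewrite !compA -(compA _ _ (fmap G _)) e !compA.
rewrite (comp_pre (esym (tensM _ _ _ _))) muVK comp1m tens1 comp1m.
rewrite muVK compm1 => ->.
by rewrite muKp.
Qed.

Lemma fmap_lunit (a : C) :
  fmap G (lunit a) = lunit (G a) ∘ ((epsV ⊗ idm _) ∘ muV uobj a).
Proof.
rewrite -(fmu_lunit G) -!compA (comp_pre (esym (tensM _ _ _ _))) epsVK comp1m.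
by rewrite tens1 comp1m muVK compm1.
Qed.

Lemma fmap_runit (a : C) :
  fmap G (runit a) = runit (G a) ∘ ((idm _ ⊗ epsV) ∘ muV a uobj).
Proof.
rewrite -(fmu_runit G) -!compA (comp_pre (esym (tensM _ _ _ _))) epsVK comp1m.
by rewrite tens1 comp1m muVK compm1.
Qed.

Lemma fmap_braid (a b : C) :
  muV b a ∘ fmap G (braid a b) = braid (G a) (G b) ∘ muV a b.
Proof.
have := congr1 (fun f => muV b a ∘ (f ∘ muV a b)) (fmu_braid G a b).
by rewrite -!compA muVK compm1 muKp.
Qed.

Let assocN := ax_assocN (smcatP D).
Let lunitN := ax_lunitN (smcatP D).
Let runitN := ax_runitN (smcatP D).
Let braidN := ax_braidN (smcatP D).

Let F_map (a b : D) (f : hom a b) : hom (r a) (r b) := p (j b ∘ (f ∘ i a)).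
Let F_mu (a b : D) : hom (r a ⊠ r b) (r (a ⊠ b)) :=
  p (j _ ∘ ((i a ⊗ i b) ∘ muV (r a) (r b))).
Let F_eps : hom uobj (r uobj) := p (j _ ∘ epsV).

Lemma iso_pair (a b : D) (f : hom a b) g :
  g ∘ f = idm _ -> f ∘ g = idm _ -> is_iso f.
Proof. by exists g. Qed.

Lemma is_iso_i d : is_iso (i d). Proof. exact: iso_pair (iK d) (jK d). Qed.
Lemma is_iso_j d : is_iso (j d). Proof. exact: iso_pair (jK d) (iK d). Qed.

Lemma is_iso_tens (a b c d : D) (f : hom a b) (g : hom c d) :
  is_iso f -> is_iso g -> is_iso (f ⊗ g).
Proof.
move=> [f' [f'f ff']] [g' [g'g gg']]; exists (f' ⊗ g').
by rewrite -!tensM f'f g'g ff' gg' !tens1.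
Qed.

(** A map is conjugated by the chosen isomorphisms [i] and [j] and pulled back along [G].
    Faithfulness lets each law be checked after applying [G], where the chosen inverses cancel. *)
Definition inverse_functor : smfunctor D C.
Proof.
refine (@Smfunctor D C r F_map F_mu F_eps _ _ _ _ _ _ _ _ _).
- by move=> a; apply: faithfulG; rewrite pK comp1m iK fmap1.
- move=> a b c f g; apply: faithfulG.
  by rewrite fmapM !pK -!compA jKp.
- move=> a b; apply: reflect_iso; rewrite pK.
  apply: is_iso_comp; last exact: is_iso_j.
  apply: is_iso_comp; first exact: iso_pair (muVK _ _) (muK _ _).
  by apply: is_iso_tens; apply: is_iso_i.
- apply: reflect_iso; rewrite pK; apply: is_iso_comp; last exact: is_iso_j.
  exact: iso_pair epsVK epsK.
- move=> a b a' b' f g; apply: faithfulG.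
  rewrite !fmapM fmap_tens !pK -!compA muKp jKp.
  by rewrite !(comp_pre (esym (tensM _ _ _ _))) !jKp.
- move=> a b c; apply: faithfulG.
  rewrite !fmapM !fmap_tens !pK !fmap1 -!compA !jKp !muKp.
  rewrite !(comp_pre (esym (tensM _ _ _ _))) !jKp fmap_assoc !compm1.
  rewrite (comp_pre (esym (tensM _ _ _ _))) -compA muK !compm1.
  rewrite (comp_pre (esym (assocN _ _ _))) -compA.
  by rewrite (comp_pre (esym (tensM _ _ _ _))) compm1.
- move=> a; apply: faithfulG.
  rewrite !fmapM !fmap_tens !pK !fmap1 fmap_lunit -!compA !jKp !muKp.
  rewrite !(comp_pre (esym (tensM _ _ _ _))) jKp compm1.
  rewrite -[in LHS](comp1m epsV) -[in LHS](compm1 (i a)) tensM.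
  rewrite -!compA (comp_pre (lunitN _)) -compA.
  by rewrite iKp.
- move=> a; apply: faithfulG.
  rewrite !fmapM !fmap_tens !pK !fmap1 fmap_runit -!compA !jKp !muKp.
  rewrite !(comp_pre (esym (tensM _ _ _ _))) jKp compm1.
  rewrite -[in LHS](comp1m epsV) -[in LHS](compm1 (i a)) tensM.
  rewrite -!compA (comp_pre (runitN _)) -compA.
  by rewrite iKp.
- move=> a b; apply: faithfulG.
  rewrite !fmapM !pK -!compA jKp fmap_braid.
  by rewrite (comp_pre (braidN _ _)) -compA.
Defined.

Lemma sm_equivalent_inverse_functor : sm_equivalent D C.
Proof.
exists inverse_functor, G; split.
- exists i; split => /=.
  + exact: is_iso_i.
  + by move=> a b f; rewrite pK jKp.
  + by move=> a b; rewrite pK -!compA jKp muK compm1 comp1m.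
  + by rewrite pK -!compA jKp epsK.
- exists (fun c => p (i (G c))); split => /=.
  + by move=> a; apply: reflect_iso; rewrite pK; apply: is_iso_i.
  + by move=> a b f; apply: faithfulG; rewrite !fmapM !pK jKp.
  + move=> a b; apply: faithfulG.
    by rewrite comp1m fmap_tens !fmapM !pK -!compA !jKp.
  + by apply: faithfulG; rewrite !fmapM !pK -!compA !jKp epsVK fmap1.
Qed.

End FullyFaithful.

(** Choice turns the existence statements into functions; the chosen isomorphisms are natural
    because the inverse acts on maps by conjugation with them. *)
Theorem sm_equivalent_of_fully_faithful (C D : smcat) (G : smfunctor C D) :
  (forall (a b : C) (h : hom (G a) (G b)), exists f, fmap G f = h) ->
  (forall (a b : C) (f g : hom a b), fmap G f = fmap G g -> f = g) ->
  (forall d : D, exists (c : C) (i : hom (G c) d), is_iso i) ->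
  sm_equivalent D C.
Proof.
move=> fullG faithfulG esoG.
pose r d := projT1 (cid (esoG d)).
pose i d : hom (G (r d)) d := projT1 (cid (projT2 (cid (esoG d)))).
have iP d : is_iso (i d) := projT2 (cid (projT2 (cid (esoG d)))).
pose j d := projT1 (cid (iP d)).
pose p (a b : C) (h : hom (G a) (G b)) := projT1 (cid (fullG a b h)).
pose muV a b := projT1 (cid (fmu_iso G a b)).
pose epsV := projT1 (cid (feps_iso G)).
apply: (@sm_equivalent_inverse_functor _ _ G fullG faithfulG r i j _ _ p _
  muV _ _ epsV).
- by move=> d; have [] := projT2 (cid (iP d)).
- by move=> d; have [] := projT2 (cid (iP d)).
- by move=> a b h; exact: projT2 (cid (fullG a b h)).
- by move=> a b; have [] := projT2 (cid (fmu_iso G a b)).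
- by move=> a b; have [] := projT2 (cid (fmu_iso G a b)).
- by have [] := projT2 (cid (feps_iso G)).
- by have [] := projT2 (cid (feps_iso G)).
Qed.

(** * The functor to Corel *)

Lemma cast_ord_bij n m (e : n = m) : bijective (cast_ord e).
Proof. by exists (cast_ord (esym e)); [apply: cast_ordK|apply: cast_ordKV]. Qed.

Lemma ord_eqhomE n m (e : n = m) :
  eqhom ord_pdata e = corel_bij (cast_ord_bij e).
Proof.
by case: m / e; apply: eq_corel_bij => i; rewrite cast_ord_id.
Qed.

Definition void_of_ord0 (i : 'I_0) : void := False_rect void (notF (ltn_ord i)).

Lemma void_of_ord0K : cancel void_of_ord0 (of_void 'I_0).
Proof. by case. Qed.

Lemma of_void_ord0K : cancel (of_void 'I_0) void_of_ord0.
Proof. by case. Qed.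

Definition corel_functor : smfunctor (smc_of_prop Th_ESCFM) Corel.
Proof.
refine (@Smfunctor (smc_of_prop Th_ESCFM) Corel (fun n : nat => 'I_n : finType)
  (fun n m t => G n m t) (fun n m => corel_bij (unsplit_bij n m))
  (corel_bij (Bijective of_void_ord0K void_of_ord0K)) _ _ _ _ _ _ _ _ _).
- move=> n; exact: (pmap1 G n).
- move=> n m k f g; exact: (pmapM G f g).
- move=> n m; exists (corel_bij (split_bij n m)); split.
    by rewrite /= corel_bijM; apply: eq_corel_bij; exact: unsplitK.
  by rewrite /= corel_bijM; apply: eq_corel_bij; exact: splitK.
- exists (corel_bij (Bijective void_of_ord0K of_void_ord0K)); split.
    by rewrite /= corel_bijM; apply: eq_corel_bij; case.
  by rewrite /= corel_bijM; apply: eq_corel_bij; case.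
- move=> n m n' m' f g; rewrite (pmapD G f g); apply: corel_ext => a b.
  rewrite compat_comp_bij.
  rewrite (compat_bij_comp _ _ (@unsplitK _ _) (@splitK _ _)).
  rewrite compat_comp_bij.
  rewrite (compat_bij_comp _ _ (@splitK _ _) (@unsplitK _ _)).
  have -> // : (a \o split) \o unsplit = a.
  by apply/funext => u /=; rewrite unsplitK.
- move=> a b c; rewrite (pmap_eqhom G) ord_eqhomE /=.
  rewrite !(corel_bijM, corel_bijD); apply: eq_corel_bij.
  (* Both bijections send an element to the same position, by associativity of addition. *)
  by move=> [[u|u]|u]; apply: val_inj; rewrite /= ?addnA.
- move=> a; rewrite (pmap_eqhom G) ord_eqhomE /=.
  rewrite !(corel_bijM, corel_bijD); apply: eq_corel_bij.
  by move=> [[]|u]; apply: val_inj.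
- move=> a; rewrite (pmap_eqhom G) ord_eqhomE /=.
  rewrite !(corel_bijM, corel_bijD); apply: eq_corel_bij.
  by move=> [u|[]]; apply: val_inj.
- move=> a b; rewrite (pmap_braid G a b) /=.
  rewrite !(corel_bijM, corel_bijD); apply: eq_corel_bij.
  by move=> u /=; rewrite /ord_braid unsplitK.
Defined.

Theorem theorem1p1 : sm_equivalent Corel (smc_of_prop Th_ESCFM).
Proof.
apply: (sm_equivalent_of_fully_faithful (G := corel_functor)).
- exact: interp_full.
- exact: interp_faithful.
(* Essential surjectivity: enumerating a finite set identifies it with an ordinal. *)
- move=> X; exists #|X|.
  exists (corel_bij (Bijective (@enum_valK X) (@enum_rankK X))).
  exists (corel_bij (Bijective (@enum_rankK X) (@enum_valK X))); split.
    by rewrite /= corel_bijM; apply: eq_corel_bij; exact: enum_valK.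
  by rewrite /= corel_bijM; apply: eq_corel_bij; exact: enum_rankK.
Qed.
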